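(* Let $k\ge1$ be an integer, $\lambda_1,\lambda_2>0$ and $0<\alpha<1$. Let $\{D_f(t)\}_{t\ge0}$ be a Lévy subordinator with associated Bernstein function $f$, such that $\mathbb{E}\left(D^r_f(t)\right)<\infty$ for all $r>0$. Let $\mathcal{Z}^{f}_{\alpha}(t)=\mathcal{S}^{k}_{\alpha}(D_f(t))$, $t\ge0$, where the fractional Skellam process of order $k$, $\{\mathcal{S}^{k}_{\alpha}(t)\}_{t\ge0}$, with parameters $\lambda_1,\lambda_2,\alpha$ is independent of $\{D_f(t)\}_{t\ge0}$. Then $\{\mathcal{Z}^{f}_{\alpha}(t)\}_{t\ge0}$ exhibits the long-range dependence (LRD) property if $$\mathbb{E}\left(D_f^{i\alpha}(t)\right)\sim k_it^{i\rho},\quad i=1,2,$$ for some $0<\rho<1$ and positive constants $k_1$ and $k_2$ such that $k_2\geq k_1^2$.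
   Context: Poisson process of order $k$ (PPoK) with intensity $\lambda>0$: $N^k(t)=\sum_{i=1}^{N(t)}X_i$, where $\{N(t)\}_{t\ge0}$ is a Poisson process with intensity $k\lambda$, and $\{X_i\}_{i\ge1}$ are iid, uniform on $\{1,2,\dots,k\}$, and independent of $\{N(t)\}_{t\ge0}$. Skellam process of order $k$ (SPoK): $S^k(t)=N_1^k(t)-N_2^k(t)$, where $\{N_1^k(t)\}_{t\ge0}$ and $\{N_2^k(t)\}_{t\ge0}$ are independent PPoK with intensities $\lambda_1>0$ and $\lambda_2>0$, respectively. Inverse stable subordinator: for $0<\alpha<1$, the stable subordinator $\{D_\alpha(t)\}_{t\ge0}$ is the subordinator with $\mathbb{E}(e^{-sD_\alpha(t)})=e^{-ts^\alpha}$, $s>0$, and $Y_\alpha(t)=\inf\{r\ge0: D_\alpha(r)>t\}$, $t\ge 0$. Fractional Skellam process of order $k$ (FSPoK), $0<\alpha<1$: $\mathcal{S}^k_\alpha(t)=S^k(Y_\alpha(t))$, where $\{Y_\alpha(t)\}_{t\ge0}$ is independent of $\{S^k(t)\}_{t\ge0}$. Lévy subordinator: a one-dimensional Lévy process $\{D_f(t)\}_{t\ge0}$ with non-decreasing sample paths, $D_f(0)=0$ a.s., and $\mathbb{E}(e^{-sD_f(t)})=e^{-tf(s)}$, where the Bernstein function $f$ is $f(s)=bs+\int_0^\infty(1-e^{-sx})\,\mu(\mathrm{d}x)$, $s>0$, with drift $b\ge0$ and non-negative Lévy measure $\mu$ satisfying $\mu([0,\infty))=\infty$ and $\int_0^\infty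 (x\wedge1)\,\mu(\mathrm{d}x)<\infty$. Notation: $D_f^r(t)=(D_f(t))^r$; for positive functions $u,v$, $u\sim v$ means $u(t)/v(t)\to1$ as $t\to\infty$. LRD property: a stochastic process $\{X(t)\}_{t\ge0}$ has the LRD property if there is $\gamma\in(0,1)$ such that for every fixed $s>0$ $$\lim_{t\to\infty}\frac{\operatorname{Cov}(X(s),X(t))}{\sqrt{\operatorname{Var}(X(s))}\sqrt{\operatorname{Var}(X(t))}\,t^{-\gamma}}=c(s)$$ for some finite nonzero constant $c(s)$ depending only on $s$. *)

(* Defs.v *)
From HB Require Import structures.
From mathcomp Require Import all_boot all_order all_algebra finmap.
From mathcomp Require Import all_classical all_reals all_analysis.

Set Implicit Arguments.
Unset Strict Implicit.
Unset Printing Implicit Defensive.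

Import Order.TTheory GRing.Theory Num.Theory.
Import numFieldNormedType.Exports.

Local Open Scope classical_set_scope.
Local Open Scope ring_scope.

(* A continuous-time process is a map X : R -> T -> U; only the values at times
   t >= 0 are constrained or used. *)

Section independence.
Context d (T : measurableType d) (R : realType) (P : probability T R).

Definition mutually_independent (I : choiceType) (F : I -> set (set T)) :=
  forall (J : {fset I}) (A : I -> set T),
    (forall i, i \in J -> F i (A i)) ->
    P (\bigcap_(i in [set` J]) A i) = (\prod_(i <- J) P (A i))%E.

(* The sigma-algebra generated by the variables X i, i in D. *)
Definition sigma_family d' (U : measurableType d') (I : Type) (D : set I)
    (X : I -> T -> U) : set (set T) :=
  <<s \bigcup_(i in D) preimage_set_system setT (X i) measurable >>.

Definition independent_families d1 (U1 : measurableType d1) (I1 : Type)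
    (D1 : set I1) (X1 : I1 -> T -> U1) d2 (U2 : measurableType d2) (I2 : Type)
    (D2 : set I2) (X2 : I2 -> T -> U2) :=
  forall A B, sigma_family D1 X1 A -> sigma_family D2 X2 B ->
    P (A `&` B) = (P A * P B)%E.

Definition independent_rvs d' (U : measurableType d') (I : choiceType)
    (X : I -> T -> U) :=
  mutually_independent (fun i => preimage_set_system setT (X i) measurable).

End independence.

Definition nonneg_times (R : realType) : set R := [set t | 0 <= t].

Section poisson_order_k.
Context d (T : measurableType d) (R : realType) (P : probability T R).

Definition poisson_process (rate : R) (N : R -> T -> nat) : Prop :=
  [/\ (forall t : R, 0 <= t -> measurable_fun setT (N t)),
      {ae P, forall w, N 0 w = 0%N},
      (forall w (s t : R), 0 <= s -> s <= t -> (N s w <= N t w)%N) /\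
      (* right-continuity of an integer-valued path *)
      (forall w (t : R), 0 <= t -> \forall s \near t^'+, N s w = N t w),
      (forall t : R^nat, 0 <= t 0%N -> nondecreasing_seq t ->
         independent_rvs P (fun i w => (N (t i.+1) w - N (t i) w)%N))
    & (forall (s t : R) n, 0 <= s -> s < t ->
         P [set w | (N t w - N s w)%N = n] =
         (poisson_pmf (rate * (t - s)) n)%:E)].

Definition iid_uniform (k : nat) (X : nat -> T -> nat) : Prop :=
  [/\ (forall i, measurable_fun setT (X i)),
      independent_rvs P X
    & forall i j, (1 <= j <= k)%N -> P [set w | X i w = j] = (k%:R^-1)%:E].

Definition PPoK (k : nat) (lambda : R) (M : R -> T -> nat) : Prop :=
  exists (N : R -> T -> nat) (X : nat -> T -> nat),
    [/\ poisson_process (k%:R * lambda) N,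
        iid_uniform k X,
        independent_families P (@nonneg_times R) N setT X
      & forall (t : R) w, 0 <= t -> M t w = (\sum_(i < N t w) X i w)%N].

Definition SPoK (k : nat) (lambda1 lambda2 : R) (S : R -> T -> R) : Prop :=
  exists M1 M2 : R -> T -> nat,
    [/\ PPoK k lambda1 M1,
        PPoK k lambda2 M2,
        independent_families P (@nonneg_times R) M1 (@nonneg_times R) M2
      & forall (t : R) w, 0 <= t -> S t w = (M1 t w)%:R - (M2 t w)%:R].

End poisson_order_k.

Section subordinators.
Context d (T : measurableType d) (R : realType) (P : probability T R).

(* Right-continuity of the paths is not required: it plays no role in the laws
   considered, and every process below has a cadlag modification. *)
Definition levy_process (X : R -> T -> R) : Prop :=
  [/\ (forall t : R, 0 <= t -> measurable_fun setT (X t)),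
      {ae P, forall w, X 0 w = 0},
      (forall t : R^nat, 0 <= t 0%N -> nondecreasing_seq t ->
         independent_rvs P (fun i w => X (t i.+1) w - X (t i) w)),
      (forall (s t : R) (B : set R), 0 <= s -> s <= t -> measurable B ->
         P [set w | B (X t w - X s w)] = P [set w | B (X (t - s) w)])
    & (forall s e : R, 0 <= s -> 0 < e ->
         P [set w | e < `|X t w - X s w|]
           @[t --> within (@nonneg_times R) (nbhs s)] --> 0%E)].

(* A subordinator takes values in [0, +oo[, so that it can be used as a random
   time for every outcome w. *)
Definition subordinator (D : R -> T -> R) : Prop :=
  [/\ levy_process D,
      (forall w (t : R), 0 <= t -> 0 <= D t w)
    & (forall w (s t : R), 0 <= s -> s <= t -> D s w <= D t w)].

Definition laplace_exponent (D : R -> T -> R) (f : R -> R) : Prop :=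
  forall t s : R, 0 <= t -> 0 < s ->
    ('E_P[fun w => expR (- (s * D t w))] = (expR (- (t * f s)))%:E)%E.

(* A Levy measure lives on ]0, +oo[; in particular it has no atom at 0. *)
Definition levy_measure (mu : {measure set R -> \bar R}) : Prop :=
  [/\ mu `]-oo, 0]%classic = 0%E,
      mu `[0, +oo[%classic = +oo%E
    & (\int[mu]_(x in `]0%R, +oo[) (Num.min x 1)%:E < +oo)%E].

Definition bernstein (f : R -> R) : Prop :=
  exists (b : R) (mu : {measure set R -> \bar R}),
    [/\ 0 <= b, levy_measure mu
      & forall s : R, 0 < s ->
          ((f s)%:E = (b * s)%:E +
            \int[mu]_(x in `]0%R, +oo[) (1 - expR (- (s * x)))%:E)%E].

Definition levy_subordinator (f : R -> R) (D : R -> T -> R) : Prop :=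
  [/\ subordinator D, bernstein f & laplace_exponent D f].

Definition stable_subordinator (alpha : R) (D : R -> T -> R) : Prop :=
  subordinator D /\ laplace_exponent D (fun s => s `^ alpha).

(* The set is empty only when the path of D is bounded by t, a null event for a
   stable subordinator; inf is then 0. *)
Definition first_passage (D : R -> T -> R) (t : R) (w : T) : R :=
  inf [set r | 0 <= r /\ t < D r w].

Definition FSPoK (k : nat) (lambda1 lambda2 alpha : R) (S : R -> T -> R)
    : Prop :=
  exists Sk D : R -> T -> R,
    [/\ SPoK P k lambda1 lambda2 Sk,
        stable_subordinator alpha D,
        independent_families P (@nonneg_times R) (first_passage D)
          (@nonneg_times R) Sk
      & forall (t : R) w, 0 <= t -> S t w = Sk (first_passage D t w) w].

End subordinators.

Definition asymp_equiv (R : realType) (u v : R -> R) : Prop :=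
  u t / v t @[t --> +oo] --> (1 : R).

(* Square integrability is what makes the covariances and variances below
   meaningful: the library's operators are total, and fine sends an infinite
   value to 0. *)
Definition LRD d (T : measurableType d) (R : realType) (P : probability T R)
    (X : R -> T -> R) : Prop :=
  (forall t : R, 0 <= t -> X t \in Lfun P 2%:E) /\
  exists gamma : R, 0 < gamma < 1 /\
    forall s : R, 0 < s -> exists2 c : R, c != 0 &
      fine (covariance P (X s) (X t)) /
        (Num.sqrt (fine 'V_P[X s]) * Num.sqrt (fine 'V_P[X t]) *
          t `^ (- gamma)) @[t --> +oo] --> c.

(* Main.v *)
Require Import Defs.
From HB Require Import structures.
From mathcomp Require Import all_boot all_order all_algebra finmap.
From mathcomp Require Import all_classical all_reals all_analysis.
From mathcomp Require Import measurable_realfun.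
From mathcomp Require Import ring lra zify.

(** Write Z_t = S (D_t) with S = Sk (Y), where Sk is a Skellam process of order k
    and Y the first passage process of a stable subordinator.  The exponent of
    the long-range dependence comes from two facts: for fixed s the covariance of
    Z_s and Z_t converges to a positive constant, whereas the variance of Z_t grows
    like kappa t^(2 gamma), with gamma = rho if Sk has a drift and gamma = rho / 2
    otherwise.

    Both facts are second moment computations, and one principle carries them: if V
    is a right continuous process independent of the random times A and B, then the
    mean of V_A V_B is the mean of K(A, B), where K(s, t) is the mean of V_s V_t
    (has_mean_subordinated_product).  It is used three times, for the sums of jumps
    at Poisson times, for Sk at the times Y, and for S at the times D.  The process
    Sk has mean m t and kernel v min(s, t) + m^2 s t (SPoK_moments), so everything
    reduces to moments of Y and of powers of D.

    The moments of Y are found without explicit densities.  Counting the points of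
    a grid of mesh h at which the stable subordinator is at most x gives an
    integer-valued approximation of Y_x, and products of such counts are double
    sums of probabilities.  Independence of the increments yields, for x <= y and
    in the limit h --> 0,
      E Y_x E Y_(y - x) <= E (Y_x Y_y) - E (Y_x^2) / 2 <= E Y_x E Y_y,
    and the uniqueness of Laplace transforms (laplace_uniqueness) gives
    self-similarity, so that E Y_x = c x^alpha and E (Y_x^2) = c2 x^(2 alpha).  As
    alpha < 1, the two bounds merge as y tends to infinity; this also shows that Y_x
    is not almost surely constant, that is, c^2 < c2 (inverse_stable_moments).

    Inserting D, the covariance of Z_s and Z_t differs from
      v c E (D_s^alpha) + m^2 c2 E (D_s^(2 alpha)) / 2
    by terms that compare D_t^alpha with (D_t - D_s)^alpha; by concavity of the power
    function these vanish as t tends to infinity (power_product_bounds).  The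
    variance of Z_t is
      v c E (D_t^alpha) + m^2 (c2 E (D_t^(2 alpha)) - c^2 (E (D_t^alpha))^2),
    and the assumed asymptotics of the moments of D, together with c^2 < c2 and
    k1^2 <= k2, give its order of growth. *)

Set Implicit Arguments.
Unset Strict Implicit.
Unset Printing Implicit Defensive.

Import Order.TTheory GRing.Theory Num.Theory.
Import numFieldNormedType.Exports.

Local Open Scope classical_set_scope.
Local Open Scope ring_scope.

(** * Expectations of real random variables *)

Section has_mean.
Context d (T : measurableType d) (R : realType) (P : probability T R).
Implicit Types (X Y : T -> R) (a b c : R).

(** Integrability and the value of the expectation travel together: with both in
    one predicate, moments can be computed by plain real arithmetic, free of the
    side conditions of the extended real line. *)
Definition has_mean X a :=
  P.-integrable setT (EFin \o X) /\ (\int[P]_w (X w)%:E = a%:E)%E.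

Lemma has_mean_measurable X a : has_mean X a -> measurable_fun setT X.
Proof. by case=> /measurable_int/measurable_EFinP. Qed.

Lemma has_mean_expectation X a : has_mean X a -> ('E_P[X] = a%:E)%E.
Proof. by case=> _ <-; rewrite unlock. Qed.

Lemma has_mean_ge0 X a : measurable_fun setT X -> (forall w, 0 <= X w) ->
  (\int[P]_w (X w)%:E = a%:E)%E -> has_mean X a.
Proof.
move=> mX X0 EX; split=> //; apply/integrableP; split; first exact/measurable_EFinP.
under eq_integral => w _ do rewrite /= ger0_norm//.
by rewrite EX ltry.
Qed.

Lemma has_mean_finite X : measurable_fun setT X -> (forall w, 0 <= X w) ->
  (\int[P]_w (X w)%:E < +oo)%E -> has_mean X (fine (\int[P]_w (X w)%:E)%E).
Proof.
move=> mX X0 EX; apply: has_mean_ge0 => //; rewrite fineK// ge0_fin_numE//.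
by apply: integral_ge0 => w _; rewrite lee_fin.
Qed.

Lemma has_mean_unique X a b : has_mean X a -> has_mean X b -> a = b.
Proof. by case=> _ Ea [_]; rewrite Ea => -[]. Qed.

Lemma has_mean_ext X Y a : (forall w, X w = Y w) -> has_mean X a -> has_mean Y a.
Proof. by move=> /funext ->. Qed.

Lemma has_mean_cst a : has_mean (fun=> a) a.
Proof.
split; last by rewrite integral_cst//= probability_setT mule1.
by have := @finite_measure_integrable_cst _ T R P setT a measurableT.
Qed.

Lemma has_meanD X Y a b : has_mean X a -> has_mean Y b ->
  has_mean (fun w => X w + Y w) (a + b).
Proof.
move=> [iX EX] [iY EY]; split; last by rewrite integralD_EFin// EX EY.
by have /= := @integrableD _ T R P setT measurableT _ _ iX iY.
Qed.

Lemma has_meanZ X a c : has_mean X a -> has_mean (fun w => c * X w) (c * a).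
Proof.
move=> [iX EX]; split.
  by have /= := @integrableZl _ T R P setT measurableT c _ iX.
by under eq_integral do rewrite EFinM; rewrite integralZl// EX.
Qed.

Lemma has_meanB X Y a b : has_mean X a -> has_mean Y b ->
  has_mean (fun w => X w - Y w) (a - b).
Proof.
move=> hX hY; rewrite -mulN1r.
apply: has_mean_ext (has_meanD hX (has_meanZ (-1) hY)) => w.
by rewrite mulN1r.
Qed.

Lemma has_mean_sum (I : eqType) (s : seq I) (X : I -> T -> R) (a : I -> R) :
  (forall i, i \in s -> has_mean (X i) (a i)) ->
  has_mean (fun w => \sum_(i <- s) X i w) (\sum_(i <- s) a i).
Proof.
elim: s => [|i s IH] h.
  by rewrite big_nil; under eq_fun do rewrite big_nil; exact: has_mean_cst.
rewrite big_cons; under eq_fun do rewrite big_cons.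
apply: has_meanD; first by apply: h; rewrite mem_head.
by apply: IH => j js; apply: h; rewrite inE js orbT.
Qed.

Lemma has_mean_ae X Y a : measurable_fun setT Y ->
  {ae P, forall w, X w = Y w} -> has_mean X a -> has_mean Y a.
Proof.
move=> mY XY hX; have [iX EX] := hX.
have mX := has_mean_measurable hX.
have aeXY : ae_eq P setT (EFin \o X) (EFin \o Y).
  by apply: filterS XY => w /= -> _.
have iY : P.-integrable setT (EFin \o Y).
  have mabs (Z : T -> R) : measurable_fun setT Z ->
      measurable_fun setT (fun w => `|(Z w)%:E|%E).
    by move=> mZ; apply: measurableT_comp => //; exact/measurable_EFinP.
  apply/integrableP; split; first exact/measurable_EFinP.
  rewrite -(@ge0_ae_eq_integral _ _ _ P setT (fun w => `|(X w)%:E|%E))//.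
  - by case/integrableP : iX.
  - exact: mabs.
  - exact: mabs.
  - by apply: filterS XY => w /= ->.
split=> //; rewrite -EX; apply/esym; apply: ae_eq_integral => //; exact/measurable_EFinP.
Qed.

(** Domination produces a mean without naming it; the value is then identified
    by has_mean_unique. *)
Lemma has_mean_dominated X Y b : measurable_fun setT X -> has_mean Y b ->
  {ae P, forall w, `|X w| <= Y w} -> exists a, has_mean X a.
Proof.
move=> mX hY XY; have [iY EY] := hY.
have mY := has_mean_measurable hY.
pose X' w := if `|X w| <= Y w then X w else 0.
have mX' : measurable_fun setT X'.
  apply: measurable_fun_ifT => //.
  by apply: measurable_fun_ler => //; exact: measurableT_comp.
have iX' : P.-integrable setT (EFin \o X').
  apply: le_integrable iY => //; first exact/measurable_EFinP.
  move=> w _ /=; rewrite lee_fin /X'; case: ifPn => [h|_].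
    exact: le_trans h (ler_norm _).
  by rewrite normr0.
exists (fine (\int[P]_w (X' w)%:E)%E).
apply: (@has_mean_ae X') => //.
  by apply: filterS XY => w; rewrite /X' => ->.
by split=> //; rewrite fineK//; exact: integrable_fin_num.
Qed.

Lemma has_mean_le X Y a b : has_mean X a -> has_mean Y b ->
  {ae P, forall w, X w <= Y w} -> a <= b.
Proof.
move=> hX hY XY; rewrite -subr_ge0.
have [iZ EZ] := has_meanB hY hX.
have := @has_mean_ae _ (fun w => `|Y w - X w|) _ _ _ (has_meanB hY hX).
case.
- apply: measurableT_comp => //; apply: measurable_funB.
    exact: has_mean_measurable hY.
  exact: has_mean_measurable hX.
- by apply: filterS XY => w h; rewrite ger0_norm// subr_ge0.
- move=> _ E; rewrite -lee_fin -E; apply: integral_ge0 => w _.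
  by rewrite lee_fin.
Qed.

Lemma has_mean_ge0_le X a : has_mean X a -> {ae P, forall w, 0 <= X w} -> 0 <= a.
Proof. by move=> hX; exact: has_mean_le (has_mean_cst 0) hX. Qed.

Lemma has_mean_indic (A : set T) p : measurable A -> P A = p%:E ->
  has_mean (\1_A) p.
Proof.
move=> mA PA; apply: has_mean_ge0.
- exact: measurable_indic.
- by move=> w; rewrite indicE.
by rewrite integral_indic// setIT.
Qed.

End has_mean.

(** * Independence and product laws *)

Section independence.
Context d (T : measurableType d) (R : realType) (P : probability T R).

(** The law of the pair (X, Y) agrees with the product law on rectangles, hence
    everywhere, and the theorem of Tonelli applies.  Taking for Y the identity map
    towards a coarser sigma-algebra turns this into a freezing lemma: whatever is
    independent of that sigma-algebra may be held fixed inside the expectation. *)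
Lemma integral_independent d1 d2 (U1 : measurableType d1)
    (U2 : measurableType d2) (X : T -> U1) (Y : T -> U2) (F : U1 * U2 -> \bar R) :
  measurable_fun setT X -> measurable_fun setT Y ->
  (forall A B, measurable A -> measurable B ->
     P (X @^-1` A `&` Y @^-1` B) = (P (X @^-1` A) * P (Y @^-1` B))%E) ->
  measurable_fun setT F -> (forall z, (0 <= F z)%E) ->
  (\int[P]_w F (X w, Y w) = \int[P]_w \int[P]_w' F (X w, Y w'))%E.
Proof.
move=> mX mY XY mF F0.
pose X' : {RV P >-> U1} := HB.pack X (isMeasurableFun.Build _ _ _ _ X mX).
pose Y' : {RV P >-> U2} := HB.pack Y (isMeasurableFun.Build _ _ _ _ Y mY).
have mZ : measurable_fun setT (fun w => (X w, Y w)) by exact: measurable_fun_pair.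
pose Z : {RV P >-> (U1 * U2)%type} :=
  HB.pack (fun w => (X w, Y w)) (isMeasurableFun.Build _ _ _ _ _ mZ).
have law : forall A, measurable A ->
    (distribution P X' \x distribution P Y')%E A = distribution P Z A.
  apply: product_measure_unique => A B mA mB.
  exact: XY.
rewrite -(@ge0_integral_distribution _ _ _ _ _ _ Z F)//.
rewrite -(@eq_measure_integral _ _ _ _ (distribution P Z)
  (distribution P X' \x distribution P Y')%E); last by move=> A mA _; exact: law.
rewrite fubini_tonelli1//.
rewrite (@ge0_integral_distribution _ _ _ _ _ _ X')//; last 2 first.
- exact: measurable_fun_fubini_tonelli_F.
- by move=> x; apply: integral_ge0 => y _; exact: F0.
apply: eq_integral => w _ /=; rewrite /fubini_F.
rewrite (@ge0_integral_distribution _ _ _ _ _ _ Y' (fun y => F (X w, y)))//.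
exact: measurableT_comp.
Qed.

Lemma has_meanM_independent (X Y : T -> R) a b :
  (forall A B : set R, measurable A -> measurable B ->
     P (X @^-1` A `&` Y @^-1` B) = (P (X @^-1` A) * P (Y @^-1` B))%E) ->
  (forall w, 0 <= X w) -> (forall w, 0 <= Y w) ->
  has_mean P X a -> has_mean P Y b ->
  has_mean P (fun w => X w * Y w) (a * b).
Proof.
move=> XY X0 Y0 hX hY.
have mX := has_mean_measurable hX; have mY := has_mean_measurable hY.
apply: has_mean_ge0.
- exact: measurable_funM.
- by move=> w; rewrite mulr_ge0.
pose F (z : R * R) : \bar R := (`|z.1| * `|z.2|)%:E.
have mF : measurable_fun setT F.
  by apply/measurable_EFinP/measurable_funM; exact: measurableT_comp.
transitivity (\int[P]_w F (X w, Y w))%E.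
  by apply: eq_integral => w _; rewrite /F /= !ger0_norm.
rewrite (integral_independent mX mY XY mF); last by move=> z; rewrite lee_fin mulr_ge0.
transitivity (\int[P]_w ((X w)%:E * b%:E))%E.
  apply: eq_integral => w _; have [iY <-] := hY.
  rewrite -integralZl//; apply: eq_integral => w' _.
  by rewrite /F /= !ger0_norm// EFinM.
by have [iX EX] := hX; rewrite integralZr// EX EFinM.
Qed.

End independence.

Section right_continuous_paths.
Context (R : realType) d (U : measurableType d).

(** Such a V is the pointwise limit of the functions obtained by replacing the
    time x by the first point of a grid of mesh 1 / n beyond x; these take
    countably many times only. *)
Lemma measurable_fun_right_continuous (V : R -> U -> R) :
  (forall t : R, 0 <= t -> measurable_fun setT (V t)) ->
  (forall (t : R) w, 0 <= t -> V s w @[s --> t^'+] --> V t w) ->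
  measurable_fun setT (fun z : R * U => V (Num.max 0 z.1) z.2).
Proof.
move=> mV rcV.
pose j n x := Num.truncn (n.+1%:R * Num.max (0 : R) x).
pose q n x : R := (j n x).+1%:R / n.+1%:R.
apply: (@measurable_fun_cvg _ _ _ _ (fun n z => V (q n z.1) z.2)).
- move=> n _ B mB; rewrite setTI.
  have -> : (fun z : R * U => V (q n z.1) z.2) @^-1` B =
      \bigcup_i ([set x | j n x = i] `*` V (i.+1%:R / n.+1%:R) @^-1` B).
    apply/seteqP; split=> [[x w] /= Bx|[x w] [i _] [/= <-]//].
    by exists (j n x).
  apply: bigcupT_measurable => i; apply: measurableX; last first.
    rewrite -[X in measurable X]setTI; apply: mV => //.
  have -> : [set x | j n x = i] =
      (fun x => n.+1%:R * Num.max 0 x) @^-1` `[i%:R, i.+1%:R[%classic.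
    apply/seteqP; split=> x /=; rewrite /j in_itv /=.
      by move=> <-; rewrite truncn_itv// mulr_ge0// le_max lexx.
    by move=> h; apply: truncn_def.
  rewrite -[X in measurable X]setTI.
  have mh : measurable_fun setT (fun x : R => n.+1%:R * Num.max 0 x).
    apply: measurable_funM => //.
    exact: (@measurable_maxr _ _ _ setT (cst 0) id).
  exact: mh.
- move=> [x w] _ /=.
  set y := Num.max 0 x.
  have y0 : 0 <= y by rewrite le_max lexx.
  have /cvg_at_rightP := rcV y w y0; apply; split.
    move=> n; rewrite /q ltr_pdivlMr// mulrC; exact: truncnS_gt.
  have q_le n : y <= q n x <= y + n.+1%:R^-1.
    rewrite /q; apply/andP; split.
      by rewrite ler_pdivlMr// mulrC ltW//; exact: truncnS_gt.
    rewrite ler_pdivrMr// mulrDl mulVf ?pnatr_eq0// -natr1 lerD2r mulrC.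
    by rewrite truncn_le mulr_ge0.
  apply: (@squeeze_cvgr _ _ _ _ (fun=> y) (fun n => y + n.+1%:R^-1)).
  - by apply: nearW => n; exact: q_le.
  - exact: cvg_cst.
  - rewrite -[X in _ --> X]addr0; apply: cvgD; first exact: cvg_cst.
    exact: cvg_harmonic.
Qed.

End right_continuous_paths.

(** * Processes evaluated at independent random times *)

Section sigma_family_space.
Context d (T : measurableType d) d' (U : measurableType d') (I : Type).
Variables (D : set I) (X : I -> T -> U).

(** On this copy of the sample space, to depend on the family X only is ordinary
    measurability, and product spaces are available. *)
Definition family_space :=
  g_sigma_algebraType (\bigcup_(i in D) preimage_set_system setT (X i) measurable).

HB.instance Definition _ := Measurable.on family_space.

Lemma measurable_family i : D i -> measurable_fun [set: family_space] (X i).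
Proof.
move=> Di _ B mB; rewrite setTI; apply: sub_sigma_algebra.
by exists i => //; exists B => //; rewrite setTI.
Qed.

Lemma family_space_sigma d2 (U2 : measurableType d2) (f : family_space -> U2)
    (B : set U2) :
  measurable_fun setT f -> measurable B -> sigma_family D X (f @^-1` B).
Proof. by move=> mf mB; have := mf measurableT B mB; rewrite setTI. Qed.

Hypothesis mX : forall i, D i -> measurable_fun setT (X i).

Lemma sigma_family_measurable A : sigma_family D X A -> measurable A.
Proof.
move: A; apply: smallest_sub; first exact: sigma_algebra_measurable.
by move=> A [i Di [B mB <-]]; exact: mX.
Qed.

Lemma measurable_family_space d2 (U2 : measurableType d2) (f : T -> U2) :
  measurable_fun [set: family_space] f -> measurable_fun setT f.
Proof.
move=> mf _ B mB; rewrite setTI.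
exact: sigma_family_measurable (family_space_sigma mf mB).
Qed.

Lemma measurable_id_family_space : measurable_fun setT (id : T -> family_space).
Proof.
move=> _ B mB; rewrite setTI.
have h : sigma_family D X B := mB.
exact: sigma_family_measurable h.
Qed.

End sigma_family_space.

Section subordination.
Context d (T : measurableType d) (R : realType) (P : probability T R).
Context d' (U : measurableType d') (I : Type) (DW : set I) (W : I -> T -> U).
Variable V : R -> T -> R.
Hypothesis mW : forall i, DW i -> measurable_fun setT (W i).
Hypothesis mV : forall t : R, 0 <= t -> measurable_fun setT (V t).
Hypothesis rcV : forall (t : R) w, 0 <= t -> V s w @[s --> t^'+] --> V t w.
Hypothesis WV : independent_families P DW W (@nonneg_times R) V.
Local Notation TW := (family_space DW W).
Local Notation TV := (family_space (@nonneg_times R) V).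
Let joint : measurable_fun setT (fun z : R * TV => V (Num.max 0 z.1) z.2).
Proof.
apply: measurable_fun_right_continuous => // t t0; exact: measurable_family.
Qed.

Lemma measurable_subordinated (A : T -> R) :
  measurable_fun [set: TW] A -> (forall w, 0 <= A w) ->
  measurable_fun setT (fun w => V (A w) w).
Proof.
move=> mA A0.
rewrite (_ : (fun _ => _) = (fun z : R * TV => V (Num.max 0 z.1) z.2) \o
   (fun w => (A w, w : TV))); last first.
  by apply/funext => w /=; rewrite max_r.
apply: measurableT_comp => //; apply: measurable_fun_pair => //.
  exact: measurable_family_space mA.
exact: measurable_id_family_space.
Qed.

Section pair_of_times.
Variables A B : T -> R.
Hypotheses (mA : measurable_fun [set: TW] A) (mB : measurable_fun [set: TW] B).
Hypotheses (A0 : forall w, 0 <= A w) (B0 : forall w, 0 <= B w).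

Let mAT : measurable_fun setT A. Proof. exact: measurable_family_space mA. Qed.
Let mBT : measurable_fun setT B. Proof. exact: measurable_family_space mB. Qed.

Section nonnegative_functional.
Variables (phi : R * R -> R) (h : R -> R -> R).
Hypotheses (mphi : measurable_fun setT phi) (phi0 : forall z, 0 <= phi z).
Hypothesis hh : forall s t : R, 0 <= s -> 0 <= t ->
  has_mean P (fun w => phi (V s w, V t w)) (h s t).

Let F (z : R * R * TV) : \bar R :=
  (phi (V (Num.max 0 z.1.1) z.2, V (Num.max 0 z.1.2) z.2))%:E.

Let mF : measurable_fun setT F.
Proof.
apply/measurable_EFinP; apply: (measurableT_comp mphi).
apply: measurable_fun_pair.
- apply: (measurableT_comp joint (g := fun z : R * R * TV => (z.1.1, z.2))).
  by apply: measurable_fun_pair => //; exact: measurableT_comp.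
- apply: (measurableT_comp joint (g := fun z : R * R * TV => (z.1.2, z.2))).
  by apply: measurable_fun_pair => //; exact: measurableT_comp.
Qed.

Let mAB : measurable_fun setT (fun w => (A w, B w)).
Proof. exact: measurable_fun_pair. Qed.

Let int_phi : (\int[P]_w (phi (V (A w) w, V (B w) w))%:E =
               \int[P]_w (h (A w) (B w))%:E)%E.
Proof.
transitivity (\int[P]_w F ((A w, B w), w : TV))%E.
  by apply: eq_integral => w _; rewrite /F /= !max_r.
rewrite (integral_independent mAB (measurable_id_family_space mV) _ mF)//.
- apply: eq_integral => w _; have [_ <-] := hh (A0 w) (B0 w).
  by apply: eq_integral => w' _; rewrite /F /= !max_r.
- move=> C E mC mE; apply: WV => //.
  apply: (@family_space_sigma _ _ _ _ _ _ _ _ _ (fun w => (A w, B w))) => //.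
  exact: measurable_fun_pair.
- by move=> z; rewrite lee_fin.
Qed.

Let mh : measurable_fun setT (fun w => h (A w) (B w)).
Proof.
pose m2 := pushforward P (id : T -> TV).
have mid := measurable_id_family_space mV.
pose idV : {RV P >-> TV} := HB.pack (id : T -> TV) (isMeasurableFun.Build _ _ _ _ _ mid).
have := @measurable_fun_fubini_tonelli_F _ _ _ _ R (distribution P idV) F mF.
move=> /(_ (fun z => ltac:(by rewrite lee_fin))) mG.
apply/measurable_EFinP.
rewrite (_ : EFin \o _ = fubini_F (distribution P idV) F \o (fun w => (A w, B w))).
  exact: measurableT_comp.
apply/funext => w /=; rewrite /fubini_F.
rewrite (@ge0_integral_distribution _ _ _ _ _ _ idV (fun y => F (A w, B w, y)))//.
- have [_ <-] := hh (A0 w) (B0 w).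
  by apply: eq_integral => w' _; rewrite /F /= !max_r.
- exact: measurableT_comp.
- by move=> y; rewrite lee_fin.
Qed.

(** The freezing lemma for the random times A and B: the mean of a nonnegative
    function of (V_A, V_B) is obtained by averaging over (A, B) its mean h(s, t) at
    deterministic times. *)
Lemma has_mean_frozen Y b : has_mean P Y b -> (forall w, h (A w) (B w) <= Y w) ->
  exists c, has_mean P (fun w => h (A w) (B w)) c /\
            has_mean P (fun w => phi (V (A w) w, V (B w) w)) c.
Proof.
move=> hY hle.
have h0 w : 0 <= h (A w) (B w).
  by apply: has_mean_ge0_le (hh (A0 w) (B0 w)) _; exact: aeW.
have [c hc] : exists c, has_mean P (fun w => h (A w) (B w)) c.
  by apply: has_mean_dominated hY _ => //; apply: aeW => w; rewrite ger0_norm.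
exists c; split=> //; apply: has_mean_ge0.
- apply: (measurableT_comp mphi).
  by apply: measurable_fun_pair; exact: measurable_subordinated.
- by move=> w; exact: phi0.
- by rewrite int_phi; case: hc.
Qed.

End nonnegative_functional.

(** Signed products are reduced to nonnegative functions by polarization,
    2 x y = (x + y)^2 - x^2 - y^2, so that only the second moments of V_A and V_B
    have to be known to be finite. *)
Lemma has_mean_subordinated_product (K : R -> R -> R) a b :
  (forall s t : R, 0 <= s -> 0 <= t -> has_mean P (fun w => V s w * V t w) (K s t)) ->
  has_mean P (fun w => K (A w) (A w)) a -> has_mean P (fun w => K (B w) (B w)) b ->
  exists c, has_mean P (fun w => K (A w) (B w)) c /\
            has_mean P (fun w => V (A w) w * V (B w) w) c.
Proof.
move=> hK hA hB.
have sqA s t : 0 <= s -> 0 <= t ->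
    has_mean P (fun w => (fun z : R * R => z.1 ^+ 2) (V s w, V t w)) (K s s).
  by move=> s0 t0 /=; apply: has_mean_ext (hK _ _ s0 s0) => w; rewrite expr2.
have sqB s t : 0 <= s -> 0 <= t ->
    has_mean P (fun w => (fun z : R * R => z.2 ^+ 2) (V s w, V t w)) (K t t).
  by move=> s0 t0 /=; apply: has_mean_ext (hK _ _ t0 t0) => w; rewrite expr2.
have sqD s t : 0 <= s -> 0 <= t ->
    has_mean P (fun w => (fun z : R * R => (z.1 + z.2) ^+ 2) (V s w, V t w))
               (K s s + K t t + 2 * K s t).
  move=> s0 t0 /=.
  apply: has_mean_ext (has_meanD (has_meanD (sqA _ _ s0 t0) (sqB _ _ s0 t0))
    (has_meanZ 2 (hK _ _ s0 t0))) => w /=; ring.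
have K2 s t : 0 <= s -> 0 <= t -> 2 * K s t <= K s s + K t t.
  move=> s0 t0; apply: (has_mean_le (has_meanZ 2 (hK _ _ s0 t0))
    (has_meanD (sqA _ _ s0 t0) (sqB _ _ s0 t0))).
  apply: aeW => w /=; have := sqr_ge0 (V s w - V t w); rewrite expr2; nra.
have m1 : measurable_fun setT (fun z : R * R => z.1 ^+ 2).
  exact: measurable_funX.
have m2 : measurable_fun setT (fun z : R * R => z.2 ^+ 2).
  exact: measurable_funX.
have m12 : measurable_fun setT (fun z : R * R => (z.1 + z.2) ^+ 2).
  by apply: measurable_funX; exact: measurable_funD.
have [p [hp1 hp2]] := has_mean_frozen m1 (fun=> sqr_ge0 _) sqA hA (fun=> lexx _).
have [q [hq1 hq2]] := has_mean_frozen m2 (fun=> sqr_ge0 _) sqB hB (fun=> lexx _).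
have [r [hr1 hr2]] := has_mean_frozen m12 (fun=> sqr_ge0 _) sqD
  (has_meanZ 2 (has_meanD hA hB)) (fun w => ltac:(by have := K2 _ _ (A0 w) (B0 w); lra)).
exists (2^-1 * (r - p - q)); split.
  apply: has_mean_ext (has_meanZ 2^-1 (has_meanB (has_meanB hr1 hp1) hq1)) => w /=.
  by field.
apply: has_mean_ext (has_meanZ 2^-1 (has_meanB (has_meanB hr2 hp2) hq2)) => w /=.
by field.
Qed.

End pair_of_times.

(** Here the reduction to nonnegative functions is 2 x = (x + 1)^2 - x^2 - 1. *)
Lemma has_mean_subordinated (A : T -> R) (m k2 : R -> R) a :
  measurable_fun [set: TW] A -> (forall w, 0 <= A w) ->
  (forall s : R, 0 <= s -> has_mean P (V s) (m s)) ->
  (forall s : R, 0 <= s -> has_mean P (fun w => V s w ^+ 2) (k2 s)) ->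
  has_mean P (fun w => k2 (A w)) a ->
  exists c, has_mean P (fun w => m (A w)) c /\ has_mean P (fun w => V (A w) w) c.
Proof.
move=> mA A0 hm hk hA.
have sq s t : 0 <= s -> 0 <= t ->
    has_mean P (fun w => (fun z : R * R => z.1 ^+ 2) (V s w, V t w)) (k2 s).
  by move=> s0 t0; exact: hk.
have sq1 s t : 0 <= s -> 0 <= t ->
    has_mean P (fun w => (fun z : R * R => (z.1 + 1) ^+ 2) (V s w, V t w))
               (k2 s + 2 * m s + 1).
  move=> s0 t0 /=.
  apply: has_mean_ext (has_meanD (has_meanD (hk _ s0) (has_meanZ 2 (hm _ s0)))
    (has_mean_cst P 1)) => w /=; ring.
have m2 s : 0 <= s -> 2 * m s <= k2 s + 1.
  move=> s0; apply: (has_mean_le (has_meanZ 2 (hm _ s0))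
    (has_meanD (hk _ s0) (has_mean_cst P 1))).
  by apply: aeW => w /=; have := sqr_ge0 (V s w - 1); rewrite !expr2; nra.
have m1 : measurable_fun setT (fun z : R * R => z.1 ^+ 2).
  exact: measurable_funX.
have m12 : measurable_fun setT (fun z : R * R => (z.1 + 1) ^+ 2).
  by apply: measurable_funX; exact: measurable_funD.
have [p [hp1 hp2]] := has_mean_frozen mA mA A0 A0 m1 (fun=> sqr_ge0 _) sq hA (fun=> lexx _).
have [r [hr1 hr2]] := has_mean_frozen mA mA A0 A0 m12 (fun=> sqr_ge0 _) sq1
  (has_meanZ 2 (has_meanD hA (has_mean_cst P 1)))
  (fun w => ltac:(by have := m2 _ (A0 w); lra)).
exists (2^-1 * (r - p - 1)); split.
  apply: has_mean_ext (has_meanZ 2^-1 (has_meanB (has_meanB hr1 hp1) (has_mean_cst P 1))) => w /=.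
  by field.
apply: has_mean_ext (has_meanZ 2^-1 (has_meanB (has_meanB hr2 hp2) (has_mean_cst P 1))) => w /=.
by field.
Qed.

End subordination.

(** * Uniqueness of Laplace transforms *)

Section bernstein_operator.
Context (R : realType).
Implicit Types (phi psi : nat -> R) (w : R).

(** The mean of phi at a binomial variable with n trials of success probability
    w, that is, the sum over j of phi(j) 'C(n, j) w^j (1 - w)^(n - j), computed by
    conditioning on one trial.  The recursion makes positivity and the binomial
    variance immediate inductions. *)
Fixpoint bernstein_op n phi w : R :=
  if n is n'.+1 then
    w * bernstein_op n' (phi \o S) w + (1 - w) * bernstein_op n' phi w
  else phi 0%N.

Lemma bernstein_opD n phi psi w :
  bernstein_op n (fun j => phi j + psi j) w =
  bernstein_op n phi w + bernstein_op n psi w.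
Proof.
elim: n phi psi => //= n IH phi psi.
rewrite -(_ : (fun j => (phi \o S) j + (psi \o S) j) = (fun j => phi j + psi j) \o S)//.
by rewrite !IH; ring.
Qed.

Lemma bernstein_opZ n a phi w :
  bernstein_op n (fun j => a * phi j) w = a * bernstein_op n phi w.
Proof.
elim: n phi => //= n IH phi.
rewrite -(_ : (fun j => a * (phi \o S) j) = (fun j => a * phi j) \o S)//.
by rewrite !IH; ring.
Qed.

Lemma bernstein_op_cst n a w : bernstein_op n (fun=> a) w = a.
Proof.
elim: n => //= n IH.
by rewrite -(_ : (fun=> a) = (fun=> a) \o S)// IH; ring.
Qed.

Lemma ler_bernstein_op n phi psi w : 0 <= w <= 1 ->
  (forall j, phi j <= psi j) -> bernstein_op n phi w <= bernstein_op n psi w.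
Proof.
move=> /andP[w0 w1]; elim: n phi psi => [|n IH] phi psi le /=; first exact: le.
apply: lerD; apply: ler_wpM2l => //; rewrite ?subr_ge0//; apply: IH => // j.
exact: le.
Qed.

Lemma bernstein_op_sqr n a w :
  bernstein_op n (fun j => (j%:R - a) ^+ 2) w =
  (n%:R * w - a) ^+ 2 + n%:R * (w * (1 - w)).
Proof.
elim: n a => [|n IH] a /=; first by ring.
rewrite IH -(_ : (fun j => (j%:R - (a - 1)) ^+ 2) = (fun j => (j%:R - a) ^+ 2) \o S).
  by rewrite IH -natr1; ring.
by apply/funext => j /=; rewrite -natr1; ring.
Qed.

(** Bernstein polynomials approximate Lipschitz functions uniformly: by the
    elementary bound |x| <= e + x^2 / e, the error is controlled by the variance of
    the binomial law. *)
Lemma bernstein_op_lipschitz (g : R -> R) (L e w : R) n :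
  0 <= L -> 0 < e -> 0 <= w <= 1 ->
  (forall x y, `|g x - g y| <= L * `|x - y|) ->
  `|bernstein_op n.+1 (fun j => g (j%:R / n.+1%:R)) w - g w| <=
  L * (e + (e * n.+1%:R)^-1).
Proof.
move=> L0 e0 w01 gL; have /andP[w0 w1] := w01.
set N : R := n.+1%:R; have N0 : 0 < N by rewrite ltr0n.
pose err (j : nat) := L * (e + (e * N ^+ 2)^-1 * (j%:R - N * w) ^+ 2).
have gerr j : `|g (j%:R / N) - g w| <= err j.
  apply: le_trans (gL _ _) _; apply: ler_wpM2l => //.
  set x := `|_|.
  have -> : (e * N ^+ 2)^-1 * (j%:R - N * w) ^+ 2 = x ^+ 2 / e.
    by rewrite /x real_normK ?num_real//; field; rewrite !gt_eqF.
  have [xe|ex] := leP x e.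
    by apply: le_trans xe _; rewrite lerDl divr_ge0 ?sqr_ge0// ltW.
  apply: (@le_trans _ _ (x ^+ 2 / e)); last by rewrite lerDr ltW.
  by rewrite ler_pdivlMr// expr2; apply: ler_wpM2l; [exact: normr_ge0|exact: ltW].
have Eerr : bernstein_op n.+1 err w <= L * (e + (e * N)^-1).
  rewrite bernstein_opZ; apply: ler_wpM2l => //.
  rewrite bernstein_opD bernstein_op_cst bernstein_opZ bernstein_op_sqr -/N.
  rewrite lerD2l subrr expr0n add0r.
  have -> : (e * N ^+ 2)^-1 * (N * (w * (1 - w))) = (e * N)^-1 * (w * (1 - w)).
    by field; rewrite !gt_eqF.
  rewrite ger_pMr ?invr_gt0 ?mulr_gt0//; nra.
have EN : bernstein_op n.+1 (fun j => - err j) w = - bernstein_op n.+1 err w.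
  rewrite -mulN1r -bernstein_opZ; congr bernstein_op.
  by apply/funext => j; rewrite mulN1r.
rewrite -[g w](bernstein_op_cst n.+1 _ w) ler_distl; apply/andP; split.
- apply: (@le_trans _ _ (bernstein_op n.+1 (fun=> g w) w - bernstein_op n.+1 err w)).
    by rewrite lerD2l lerN2.
  rewrite -EN -bernstein_opD; apply: ler_bernstein_op => // j.
  by have := gerr j; rewrite ler_distl => /andP[].
- apply: (@le_trans _ _ (bernstein_op n.+1 (fun=> g w) w + bernstein_op n.+1 err w)).
    rewrite -bernstein_opD; apply: ler_bernstein_op => // j.
    by have := gerr j; rewrite ler_distl => /andP[].
  by rewrite lerD2l.
Qed.

End bernstein_operator.

Section laplace_uniqueness.
Context d (T : measurableType d) (R : realType) (P : probability T R).

Definition same_mean (X Y : T -> R) := exists a, has_mean P X a /\ has_mean P Y a.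

Lemma same_mean_bernstein (V W : T -> R) :
  (forall i : nat, same_mean (fun w => V w ^+ i) (fun w => W w ^+ i)) ->
  forall n phi, same_mean (fun w => bernstein_op n phi (V w))
                          (fun w => bernstein_op n phi (W w)).
Proof.
move=> VW n phi.
suff : forall i, same_mean (fun w => V w ^+ i * bernstein_op n phi (V w))
                           (fun w => W w ^+ i * bernstein_op n phi (W w)).
  move=> /(_ 0%N) [a [hV hW]]; exists a; split.
    by apply: has_mean_ext hV => w; rewrite expr0 mul1r.
  by apply: has_mean_ext hW => w; rewrite expr0 mul1r.
elim: n phi => [|n IH] phi i.
  have [a [hV hW]] := VW i; exists (phi 0%N * a); split.
    by apply: has_mean_ext (has_meanZ (phi 0%N) hV) => w /=; rewrite mulrC.
  by apply: has_mean_ext (has_meanZ (phi 0%N) hW) => w /=; rewrite mulrC.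
have [a [hVa hWa]] := IH (phi \o S) i.+1.
have [b [hVb hWb]] := IH phi i.
have [c [hVc hWc]] := IH phi i.+1.
exists (a + (b - c)); split.
  by apply: has_mean_ext (has_meanD hVa (has_meanB hVb hVc)) => w /=; rewrite exprS; ring.
by apply: has_mean_ext (has_meanD hWa (has_meanB hWb hWc)) => w /=; rewrite exprS; ring.
Qed.

(** Two variables in [0, 1] with the same moments give the same mean to all
    polynomials, hence to all uniform limits of polynomials. *)
Lemma same_mean_lipschitz (V W : T -> R) (g : R -> R) (L a b : R) :
  (forall w, 0 <= V w <= 1) -> (forall w, 0 <= W w <= 1) ->
  (forall i : nat, same_mean (fun w => V w ^+ i) (fun w => W w ^+ i)) ->
  0 <= L -> (forall x y, `|g x - g y| <= L * `|x - y|) ->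
  has_mean P (g \o V) a -> has_mean P (g \o W) b -> a <= b.
Proof.
move=> V01 W01 VW L0 gL ha hb; apply/ler_addgt0Pr => e0 e0_gt0.
have [e e_gt0 eE] : exists2 e, 0 < e & (L + 1) * (4 * e) = e0.
  exists (e0 / (4 * (L + 1))); first by rewrite divr_gt0// mulr_gt0// ltr_wpDl.
  by field; rewrite gt_eqF// ltr_wpDl.
pose n := Num.truncn (e ^- 2).
have ne : (e * n.+1%:R)^-1 <= e.
  have := truncnS_gt (e ^- 2); rewrite -/n => /ltW h.
  rewrite -[leRHS]invrK lef_pV2 ?posrE ?mulr_gt0 ?invr_gt0//.
  apply: le_trans (_ : e * e ^- 2 <= _); last by rewrite ler_pM2l.
  by rewrite (_ : e * e ^- 2 = e^-1)//; field; rewrite gt_eqF.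
have [c [hc1 hc2]] := same_mean_bernstein VW n.+1 (fun j => g (j%:R / n.+1%:R)).
pose E := L * (e + (e * n.+1%:R)^-1).
have h1 : a <= c + E.
  apply: (has_mean_le ha (has_meanD hc1 (has_mean_cst P E))); apply: aeW => w /=.
  have := bernstein_op_lipschitz n L0 e_gt0 (V01 w) gL.
  by rewrite ler_distlC => /andP[_].
have h2 : c <= b + E.
  apply: (has_mean_le hc2 (has_meanD hb (has_mean_cst P E))); apply: aeW => w /=.
  have := bernstein_op_lipschitz n L0 e_gt0 (W01 w) gL.
  by rewrite ler_distl => /andP[_].
apply: (@le_trans _ _ (b + 2 * E)); first by lra.
rewrite lerD2l.
have : E <= L * (2 * e).
  by apply: ler_wpM2l => //; rewrite (_ : 2 * e = e + e) ?lerD2l//; ring.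
by rewrite -eE; nra.
Qed.

(** A Lipschitz majorant of the indicator of [c, +oo[ which vanishes up to
    c - 1 / m. *)
Definition ramp (m c w : R) : R := Num.min 1 (Num.max 0 (1 + m * (w - c))).

Lemma ramp_lipschitz m c x y : 0 <= m -> `|ramp m c x - ramp m c y| <= m * `|x - y|.
Proof.
move=> m0.
have -> : m * `|x - y| = `|(1 + m * (x - c)) - (1 + m * (y - c))|.
  by rewrite (_ : 1 + _ - _ = m * (x - y)) ?normrM ?(ger0_norm m0)//; ring.
rewrite /ramp; set u := 1 + _; set v := 1 + _.
rewrite /Num.min /Num.max ler_norml.
by case: (ltrP 0 u) => ?; case: (ltrP 0 v) => ?; rewrite ?ltr10;
  do ?[case: ltrP => ?]; have := ler_norm (u - v); have := ler_norm (v - u);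
  rewrite (distrC v u) => ? ?; apply/andP; split; lra.
Qed.

(** The values of the Laplace transform of X at the integers are the moments of
    expR (- X), which lies in [0, 1], and X <= x means expR (- X) >= expR (- x). *)
Lemma laplace_le (X Y : T -> R) :
  measurable_fun setT X -> measurable_fun setT Y ->
  (forall w, 0 <= X w) -> (forall w, 0 <= Y w) ->
  (forall n : nat, same_mean (fun w => expR (- (n.+1%:R * X w)))
                             (fun w => expR (- (n.+1%:R * Y w)))) ->
  forall x e : R, 0 < e ->
    (P [set w | (X w <= x)%R] <= P [set w | (Y w <= x + e)%R])%E.
Proof.
move=> mX mY X0 Y0 XY x e e0.
have exp01 (Z : T -> R) : (forall w, 0 <= Z w) -> forall w, 0 <= expR (- Z w) <= 1.
  by move=> Z0 w; rewrite expR_ge0 -expR0 ler_expR oppr_le0 Z0.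
have moments i : same_mean (fun w => expR (- X w) ^+ i) (fun w => expR (- Y w) ^+ i).
  case: i => [|n].
    by exists 1; split; under eq_fun do rewrite expr0; exact: has_mean_cst.
  have [a [ha hb]] := XY n; exists a; split.
    by apply: has_mean_ext ha => w; rewrite -mulrN mulrC expRM_natr.
  by apply: has_mean_ext hb => w; rewrite -mulrN mulrC expRM_natr.
pose c := expR (- x); pose m := (c - expR (- (x + e)))^-1.
have m0 : 0 < m by rewrite invr_gt0 subr_gt0 ltr_expR; lra.
have mramp : measurable_fun setT (ramp m c).
  apply: (@measurable_minr _ _ _ setT (cst 1)) => //.
  apply: (@measurable_maxr _ _ _ setT (cst 0)) => //.
  apply: measurable_funD => //; apply: measurable_funM => //.
  exact: measurable_funB.
have hramp (Z : T -> R) : measurable_fun setT Z ->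
    exists a, has_mean P (ramp m c \o (fun w => expR (- Z w))) a.
  move=> mZ; apply: (has_mean_dominated _ (has_mean_cst P 1)).
    apply: measurableT_comp => //; apply: measurableT_comp => //.
    exact: measurableT_comp.
  apply: aeW => w /=; rewrite ger0_norm /ramp ?ge_min ?lexx//.
  by rewrite le_min ler01 le_max lexx.
have [a ha] := hramp X mX; have [b hb] := hramp Y mY.
have mle (Z : T -> R) z : measurable_fun setT Z -> measurable [set w | Z w <= z].
  move=> mZ; have := mZ measurableT `]-oo, z]%classic (measurable_itv _).
  by rewrite setTI; congr (measurable _); apply/seteqP; split=> w /=; rewrite in_itv.
have PF A : measurable A -> P A = (fine (P A))%:E.
  by move=> mA; rewrite fineK// fin_num_measure.
rewrite (PF _ (mle _ _ mX)) (PF _ (mle _ _ mY)) lee_fin.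
have hX := has_mean_indic (mle _ x mX) (PF _ (mle _ x mX)).
have hY := has_mean_indic (mle _ (x + e) mY) (PF _ (mle _ (x + e) mY)).
apply: (@le_trans _ _ a).
  apply: (has_mean_le hX ha); apply: aeW => w /=; rewrite indicE.
  have [/set_mem /= Xx|_] := boolP (_ \in _); last first.
    by rewrite /ramp le_min ler01 le_max lexx.
  rewrite /ramp le_min lexx le_max; apply/orP; right.
  by rewrite lerDl mulr_ge0 ?(ltW m0)// subr_ge0 ler_expR lerN2.
apply: (@le_trans _ _ b).
  exact: (same_mean_lipschitz (exp01 _ X0) (exp01 _ Y0) moments (ltW m0)
    (fun u v => ramp_lipschitz c u v (ltW m0)) ha hb).
apply: (has_mean_le hb hY); apply: aeW => w /=; rewrite indicE.
have [_|/negP Yx] := boolP (_ \in _); first by rewrite ge_min lexx.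
have {}Yx : x + e < Y w.
  by rewrite ltNge; apply/negP => h; apply: Yx; exact: mem_set.
rewrite /ramp ge_min; apply/orP; right; rewrite ge_max lexx /=.
have h : expR (- Y w) - c <= - m^-1.
  by rewrite /m invrK opprB lerB// ler_expR lerN2 ltW.
have := ler_wpM2l (ltW m0) h; rewrite mulrN mulfV ?gt_eqF//; lra.
Qed.

Lemma laplace_uniqueness (X Y : T -> R) :
  measurable_fun setT X -> measurable_fun setT Y ->
  (forall w, 0 <= X w) -> (forall w, 0 <= Y w) ->
  (forall n : nat, same_mean (fun w => expR (- (n.+1%:R * X w)))
                             (fun w => expR (- (n.+1%:R * Y w)))) ->
  forall x : R, P [set w | X w <= x] = P [set w | Y w <= x].
Proof.
have half : forall X Y : T -> R,
    measurable_fun setT X -> measurable_fun setT Y ->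
    (forall w, 0 <= X w) -> (forall w, 0 <= Y w) ->
    (forall n : nat, same_mean (fun w => expR (- (n.+1%:R * X w)))
                               (fun w => expR (- (n.+1%:R * Y w)))) ->
    forall x : R, (P [set w | (X w <= x)%R] <= P [set w | (Y w <= x)%R])%E.
  move=> {}X {}Y mX mY X0 Y0 XY x.
  pose Y' : {RV P >-> R} := HB.pack Y (isMeasurableFun.Build _ _ _ _ Y mY).
  have rc := @cdf_right_continuous _ _ _ P Y' x.
  have cdfE z : cdf Y' z = P [set w | Y w <= z].
    have -> : [set w | Y w <= z] = Y @^-1` `]-oo, z]%classic.
      by apply/seteqP; split=> w /=; rewrite in_itv.
    by [].
  rewrite -(cdfE x); apply: (cvge_ge _ rc).
  near=> y; rewrite cdfE (_ : y = x + (y - x)); last by rewrite addrC subrK.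
  by apply: laplace_le => //; rewrite subr_gt0.
move=> mX mY X0 Y0 XY x; apply/eqP; rewrite eq_le; apply/andP; split; first exact: half.
apply: half => // n; have [a [ha hb]] := XY n.
by exists a; split.
Unshelve. all: end_near. Qed.

End laplace_uniqueness.

(** * Discrete distributions and the Poisson process *)

Section discrete_moments.
Context d (T : measurableType d) (R : realType) (P : probability T R).

Lemma has_mean0_ae (X : T -> R) : (forall w, 0 <= X w) -> has_mean P X 0 ->
  {ae P, forall w, X w = 0}.
Proof.
move=> X0 hX; have [iX EX] := hX; have mX := has_mean_measurable hX.
have [+ _] := @ae_eq_integral_abs _ _ _ P setT measurableT (EFin \o X)
  (proj2 (measurable_EFinP _ _) mX).
have -> : (\int[P]_w `|(EFin \o X) w| = 0)%E.
  by rewrite -[RHS]EX; apply: eq_integral => w _; rewrite /= ger0_norm.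
move=> /(_ erefl); apply: filterS => w /= h.
by have := h I => -[].
Qed.

Lemma integral_nat (N : T -> nat) (phi : nat -> R) :
  measurable_fun setT N -> (forall n, 0 <= phi n) ->
  (\int[P]_w (phi (N w))%:E = \sum_(n <oo) (phi n)%:E * P [set w | N w = n])%E.
Proof.
move=> mN phi0.
have mF n : measurable [set w | N w = n].
  by have := mN measurableT [set n] I; rewrite setTI.
have UF : setT = \bigcup_n [set w | N w = n].
  by apply/seteqP; split=> // w _; exists (N w).
rewrite {1}UF ge0_integral_bigcup//.
- apply: eq_eseriesr => n _.
  under eq_integral => w do [rewrite inE /= => ->].
  by rewrite integral_cst.
- rewrite -UF; apply/measurable_EFinP; exact: measurableT_comp.
- by move=> w _; rewrite lee_fin.
- by move=> i j _ _ [w [/= <- <-]].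
Qed.

Lemma poisson_pmfS (r : R) n : 0 < r ->
  n.+1%:R * poisson_pmf r n.+1 = r * poisson_pmf r n.
Proof.
move=> r0; rewrite /poisson_pmf r0 factS natrM exprS.
field; rewrite nat1r !pnatr_eq0 -lt0n fact_gt0//.
Qed.

(** The identity n p(n) = r p(n - 1) between the weights of the Poisson law turns
    each moment into a shifted series of lower degree. *)
Lemma poisson_moments (N : T -> nat) (r : R) :
  measurable_fun setT N -> 0 < r ->
  (forall n, P [set w | N w = n] = (poisson_pmf r n)%:E) ->
  has_mean P (fun w => (N w)%:R) r /\ has_mean P (fun w => (N w)%:R ^+ 2) (r ^+ 2 + r).
Proof.
move=> mN r0 PN.
have mNR : measurable_fun setT (fun w => (N w)%:R : R) by exact: measurableT_comp.
have EN phi : (forall n, 0 <= phi n) -> (\int[P]_w (phi (N w))%:E =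
    \sum_(n <oo) (phi n * poisson_pmf r n)%:E)%E.
  by move=> phi0; rewrite integral_nat//; apply: eq_eseriesr => n _; rewrite PN EFinM.
have pmf0 n : 0 <= poisson_pmf r n by exact: poisson_pmf_ge0.
have shift (phi : nat -> R) : (forall n, 0 <= phi n) -> phi 0%N = 0 ->
    (\int[P]_w (phi (N w))%:E =
     \sum_(n <oo) (phi n.+1 * poisson_pmf r n.+1)%:E)%E.
  move=> phi0 phi00; rewrite EN// nneseries_recl//; last first.
    by move=> n _; rewrite lee_fin mulr_ge0.
  rewrite phi00 mul0r add0e -(@nneseries_addn _ (fun n => (phi n * poisson_pmf r n)%:E))//.
    by apply: eq_eseriesr => n _; rewrite addn1.
  by move=> n; rewrite lee_fin mulr_ge0.
have E1 : (\sum_(n <oo) (poisson_pmf r n)%:E = 1)%E.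
  transitivity (\int[P]_w (1%R)%:E)%E.
    rewrite (EN (fun=> 1))//; apply: eq_eseriesr => n _; by rewrite mul1r.
  by rewrite integral_cst//= probability_setT mule1.
have EN1 : (\int[P]_w ((N w)%:R : R)%:E = r%:E)%E.
  rewrite (shift (fun n => n%:R))//.
  under eq_eseriesr => n _ do rewrite poisson_pmfS// EFinM.
  by rewrite nneseriesZl ?E1 ?mule1// => n _; rewrite lee_fin.
split.
  by apply: has_mean_ge0.
apply: has_mean_ge0.
- exact: measurable_funX.
- by move=> w; exact: sqr_ge0.
rewrite (shift (fun n => n%:R ^+ 2) (fun=> sqr_ge0 _)) ?expr0n//.
under eq_eseriesr => n _.
  rewrite (_ : _ * _ = r * (n%:R * poisson_pmf r n + poisson_pmf r n)); last first.
    by rewrite expr2 -mulrA poisson_pmfS// -natr1; ring.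
  rewrite EFinM; over.
rewrite /= nneseriesZl; last by move=> n _; rewrite lee_fin addr_ge0 ?mulr_ge0.
under eq_eseriesr => n _ do rewrite EFinD.
rewrite nneseriesD; last 2 first.
- by move=> n _ _; rewrite lee_fin mulr_ge0.
- by move=> n _ _; rewrite lee_fin.
rewrite E1 -(EN (fun n => n%:R))// EN1 -EFinD -EFinM; congr EFin; ring.
Qed.

Lemma independent_rvs_pair d' (U : measurableType d') (X : nat -> T -> U) i j
    (A B : set U) : i != j ->
  independent_rvs P X -> measurable A -> measurable B ->
  P (X i @^-1` A `&` X j @^-1` B) = (P (X i @^-1` A) * P (X j @^-1` B))%E.
Proof.
move=> ij iX mA mB.
pose E n := if n == i then X i @^-1` A else X j @^-1` B.
have := iX [fset i; j]%fset E.
have -> : \bigcap_(n in [set` [fset i; j]%fset]) E n = X i @^-1` A `&` X j @^-1` B.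
  apply/seteqP; split=> w.
    move=> h; split.
      by have := h i; rewrite /= !inE eqxx /E eqxx; exact.
    by have := h j; rewrite /= !inE eqxx orbT /E eq_sym (negbTE ij); exact.
  move=> [hA hB] n; rewrite /= !inE => /orP[/eqP ->|/eqP ->]; rewrite /E ?eqxx//.
  by rewrite eq_sym (negbTE ij).
rewrite big_fsetU1/= ?inE// big_seq_fset1 /E eqxx eq_sym (negbTE ij) => -> //.
move=> n; rewrite !inE => /orP[/eqP ->|/eqP ->].
  by rewrite eqxx; exists A => //; rewrite setTI.
by rewrite eq_sym (negbTE ij); exists B => //; rewrite setTI.
Qed.

End discrete_moments.

Section poisson.
Context d (T : measurableType d) (R : realType) (P : probability T R).
Variables (rate : R) (N : R -> T -> nat).
Hypothesis rate0 : 0 < rate.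
Hypothesis hN : poisson_process P rate N.

Let mN (t : R) : 0 <= t -> measurable_fun setT (N t).
Proof. by case: hN => + _ _ _ _; exact. Qed.

Let N_le w (s t : R) : 0 <= s -> s <= t -> (N s w <= N t w)%N.
Proof. by case: hN => _ _ [+ _] _ _; exact. Qed.

Lemma measurable_natr_fun d' (U : measurableType d') (f : U -> nat) :
  measurable_fun setT f -> measurable_fun setT (fun w => (f w)%:R : R).
Proof. by move=> mf; exact: measurableT_comp. Qed.

Lemma poisson_increment (s t : R) : 0 <= s -> s <= t ->
  has_mean P (fun w => (N t w)%:R - (N s w)%:R) (rate * (t - s)) /\
  has_mean P (fun w => ((N t w)%:R - (N s w)%:R) ^+ 2)
    ((rate * (t - s)) ^+ 2 + rate * (t - s)).
Proof.
move=> s0; rewrite le_eqVlt => /orP[/eqP <-|st].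
  rewrite subrr mulr0 expr0n addr0; split; apply: has_mean_ext (has_mean_cst P 0) => w;
  by rewrite subrr ?expr0n.
have t0 : 0 <= t by rewrite (le_trans s0) ?ltW.
have r0 : 0 < rate * (t - s) by rewrite mulr_gt0// subr_gt0.
have mI : measurable_fun setT (fun w => (N t w - N s w)%N).
  move=> _ B mB; rewrite setTI.
  have -> : (fun w => (N t w - N s w)%N) @^-1` B =
    \bigcup_i \bigcup_j ([set w | N t w = i] `&` [set w | N s w = j] `&`
                         [set w | B (i - j)%N]).
    apply/seteqP; split=> [w /= Bw|w [i _ [j _ [[/= -> ->]]]]//].
    by exists (N t w) => //; exists (N s w).
  apply: bigcupT_measurable => i; apply: bigcupT_measurable => j.
  apply: measurableI.
    apply: measurableI.
      by have := mN t0 measurableT (I : measurable [set i]); rewrite setTI.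
    by have := mN s0 measurableT (I : measurable [set j]); rewrite setTI.
  have [h|h] := pselect (B (i - j)%N).
    by rewrite (_ : [set _ | _] = setT)//; apply/seteqP; split.
  by rewrite (_ : [set _ | _] = set0)//; apply/seteqP; split.
have law n : P [set w | (N t w - N s w)%N = n] = (poisson_pmf (rate * (t - s)) n)%:E.
  by case: hN => _ _ _ _; exact.
have [h1 h2] := poisson_moments mI r0 law.
split; [apply: has_mean_ext h1|apply: has_mean_ext h2] => w;
  by rewrite natrB// N_le// ltW.
Qed.

Let N00 : {ae P, forall w, N 0 w = 0%N}.
Proof. by case: hN. Qed.

Lemma poisson_mean (t : R) : 0 <= t ->
  has_mean P (fun w => (N t w)%:R) (rate * t).
Proof.
move=> t0; have [h _] := poisson_increment (lexx 0) t0; rewrite subr0 in h.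
apply: has_mean_ae h; first exact/measurable_natr_fun/mN.
by apply: filterS N00 => w ->; rewrite subr0.
Qed.

(** For s <= t, write N_t as N_s plus an increment independent of N_s. *)
Lemma poisson_product (s t : R) : 0 <= s -> 0 <= t ->
  has_mean P (fun w => (N s w)%:R * (N t w)%:R)
    (rate * Num.min s t + rate ^+ 2 * (s * t)).
Proof.
wlog st : s t / s <= t.
  move=> h s0 t0; have [st|ts] := leP s t; first by have := h _ _ st s0 t0; rewrite min_l.
  have := h _ _ (ltW ts) t0 s0; rewrite min_l ?ltW// [t * s]mulrC; apply: has_mean_ext => w.
  by rewrite mulrC.
move=> s0 t0; rewrite min_l//.
have [h1 h2] := poisson_increment (lexx 0) s0; rewrite subr0 in h1 h2.
have [g1 _] := poisson_increment s0 st.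
pose u (n : nat) := if n is n'.+1 then (if n' is 0%N then s else t) else (0 : R).
have indep : independent_rvs P (fun i w => (N (u i.+1) w - N (u i) w)%N).
  case: hN => _ _ _ + _; apply => //.
  by apply/nondecreasing_seqP => -[|[|n]] /=.
have hprod : has_mean P (fun w => ((N s w)%:R - (N 0 w)%:R) * ((N t w)%:R - (N s w)%:R))
    (rate * s * (rate * (t - s))).
  apply: has_meanM_independent => //.
  - move=> A B mA mB.
    have := @independent_rvs_pair _ _ _ P _ _ _ 0%N 1%N
      [set n : nat | A (n%:R : R)] [set n : nat | B (n%:R : R)] isT indep I I.
    have pre (E : set R) (x y : R) : 0 <= x -> x <= y ->
        (fun w => (N y w)%:R - (N x w)%:R : R) @^-1` E =
        (fun w => (N y w - N x w)%N) @^-1` [set n : nat | E (n%:R : R)].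
      by move=> x0 xy; apply/seteqP; split=> w /=; rewrite natrB// N_le.
    by rewrite !pre.
  - by move=> w; rewrite subr_ge0 ler_nat N_le.
  - by move=> w; rewrite subr_ge0 ler_nat N_le.
have := has_meanD h2 hprod.
have -> : (rate * s) ^+ 2 + rate * s + rate * s * (rate * (t - s)) =
  rate * s + rate ^+ 2 * (s * t) by ring.
apply: has_mean_ae.
  by apply: measurable_funM; apply/measurable_natr_fun/mN.
by apply: filterS N00 => w ->; rewrite !subr0; ring.
Qed.

End poisson.

(** * Poisson and Skellam processes of order k *)

Section order_k.
Context d (T : measurableType d) (R : realType) (P : probability T R).

Lemma has_mean_uniform (k : nat) (X : T -> nat) (phi : nat -> R) :
  (0 < k)%N -> measurable_fun setT X ->
  (forall j, (1 <= j <= k)%N -> P [set w | X w = j] = (k%:R^-1)%:E) ->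
  has_mean P (fun w => phi (X w)) (k%:R^-1 * \sum_(j < k) phi j.+1).
Proof.
move=> k0 mX PX.
have mE j : measurable [set w | X w = j].
  by have := mX measurableT [set j] I; rewrite setTI.
have hI (j : 'I_k) : has_mean P (\1_[set w | X w = j.+1]) (k%:R^-1).
  by apply: has_mean_indic => //; apply: PX; exact: ltn_ord.
have indE (psi : nat -> R) w : (1 <= X w <= k)%N ->
    \sum_(j < k) psi j.+1 * \1_[set w | X w = j.+1] w = psi (X w).
  case EX : (X w) => [//|n] /= nk.
  rewrite (bigD1 (Ordinal nk)) //= indicE mem_set// mulr1 big1 ?addr0// => j jn.
  rewrite indicE memNset ?mulr0//= EX => -[nj].
  by move/eqP: jn; apply; exact: val_inj.
have hS psi : has_mean P (fun w => \sum_(j < k) psi j.+1 * \1_[set w | X w = j.+1] w)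
    (k%:R^-1 * \sum_(j < k) psi j.+1).
  rewrite mulr_sumr; apply: has_mean_sum => j _.
  by rewrite mulrC; apply: has_meanZ; exact: hI.
have hS1 : has_mean P
    (fun w => 1 - \sum_(j < k) 1 * \1_[set w | X w = j.+1] w) 0.
  have := has_meanB (has_mean_cst P 1) (hS (fun=> 1)).
  rewrite sumr_const card_ord mulVf ?subrr// pnatr_eq0; by case: (k) k0.
have range : {ae P, forall w, (1 <= X w <= k)%N}.
  have := has_mean0_ae _ hS1; case=> [w|].
    have [Xw|Xw] := boolP (1 <= X w <= k)%N.
      by rewrite (indE (fun=> 1))// subrr.
    rewrite big1 ?subr0// => j _; rewrite indicE memNset ?mulr0//= => EX.
    by move: Xw; rewrite EX /= ltn_ord.
  move=> A [mA PA0 sub]; exists A; split => // w /= nXw; apply: sub => /=.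
  rewrite big1 ?subr0; first by move=> /eqP; rewrite oner_eq0.
  move=> j _; rewrite indicE memNset ?mulr0//= => EX.
  by apply: nXw; rewrite EX /= ltn_ord.
apply: has_mean_ae (hS phi); first exact: measurableT_comp.
by apply: filterS range => w; exact: indE.
Qed.

Lemma sum_diagonal (m n : nat) (a b : R) :
  \sum_(i < m) \sum_(j < n) (if val i == val j then b else a) =
  (b - a) * (minn m n)%:R + a * (m%:R * n%:R).
Proof.
have inner i : \sum_(j < n) (if i == val j then b else a) =
    (b - a) * (i < n)%:R + a * n%:R.
  have -> : \sum_(j < n) (if i == val j then b else a) =
      \sum_(j < n) ((b - a) * (i == val j)%:R + a).
    by apply: eq_bigr => j _; case: eqP => _; rewrite ?mulr1 ?mulr0; ring.
  rewrite big_split /= sumr_const card_ord -mulr_sumr -[a *+ n]mulr_natr; congr (_ * _ + _).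
  have [ilt|ige] := ltnP i n.
    rewrite (bigD1 (Ordinal ilt)) //= eqxx big1 ?addr0// => j.
    by rewrite -val_eqE /= eq_sym => /negbTE ->.
  by rewrite big1// => j _; rewrite gtn_eqF// (leq_trans (ltn_ord j)).
under eq_bigr do rewrite inner.
rewrite big_split /= -mulr_sumr sumr_const card_ord -[_ *+ m]mulr_natr.
congr (_ * _ + _); last by ring.
elim: m => [|m IH]; first by rewrite big_ord0 min0n.
by rewrite big_ord_recr /= IH -natrD; congr _%:R; case: (ltnP m n) => ?; lia.
Qed.

Section random_sums.
Variables (k : nat) (lambda : R) (M : R -> T -> nat).
Hypotheses (k0 : (0 < k)%N) (lambda0 : 0 < lambda) (hM : PPoK P k lambda M).

(** A Poisson process of order k is the process of partial sums of the jumps,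
    evaluated at the independent time N_t; making the partial sums a right
    continuous function of a real time lets the results on random times apply.
    The resulting second moments are those of a process with stationary independent
    increments, mean a t and variance b t. *)
Lemma PPoK_moments : exists a b : R, [/\ 0 < b,
  (forall t : R, 0 <= t -> measurable_fun setT (M t)),
  (forall (t : R) w, 0 <= t -> \forall s \near t^'+, M s w = M t w),
  (forall t : R, 0 <= t -> has_mean P (fun w => (M t w)%:R) (a * t)) &
  (forall s t : R, 0 <= s -> 0 <= t ->
     has_mean P (fun w => (M s w)%:R * (M t w)%:R)
       (b * Num.min s t + a ^+ 2 * (s * t)))].
Proof.
have [N [X [hN [mX iX PX] NX ME]]] := hM.
have rate0 : 0 < k%:R * lambda by rewrite mulr_gt0// ltr0n.
have [mN _ [N_le N_rc] _ _] := hN.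
pose mu : R := k%:R^-1 * \sum_(j < k) j.+1%:R.
pose q : R := k%:R^-1 * \sum_(j < k) j.+1%:R ^+ 2.
have q0 : 0 < q.
  rewrite mulr_gt0 ?invr_gt0 ?ltr0n//; case: (k) k0 => // n _.
  rewrite big_ord_recl ltr_pwDl// ?expr1n// sumr_ge0// => j _; exact: sqr_ge0.
have hX i : has_mean P (fun w => (X i w)%:R) mu.
  exact: (has_mean_uniform (fun n => n%:R) k0 (mX i) (PX i)).
have hXX i j : has_mean P (fun w => (X i w)%:R * (X j w)%:R)
    (if i == j then q else mu ^+ 2).
  have [->|ij] := eqVneq i j.
    have := has_mean_uniform (fun n => n%:R ^+ 2) k0 (mX j) (PX j).
    by apply: has_mean_ext => w; rewrite expr2.
  rewrite expr2; apply: has_meanM_independent => // A B mA mB.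
  exact: (@independent_rvs_pair _ _ _ P _ _ _ i j
    [set n : nat | A (n%:R : R)] [set n : nat | B (n%:R : R)] ij iX I I).
pose V (u : R) w : R := \sum_(i < Num.truncn u) (X i w)%:R.
have mV (t : R) : 0 <= t -> measurable_fun setT (V t).
  by move=> t0; apply: measurable_sum => i; exact: measurable_natr_fun.
have V_rc (t : R) w : 0 <= t -> V s w @[s --> t^'+] --> V t w.
  move=> t0; apply: cvg_near_cst; near=> s.
  rewrite /V; have -> // : Num.truncn s = Num.truncn t.
  apply: truncn_def; apply/andP; split.
    by rewrite (@le_trans _ _ t) ?truncn_le//; near: s; exact: nbhs_right_ge.
  by near: s; apply: nbhs_right_lt; exact: truncnS_gt.
have NV : independent_families P (@nonneg_times R) N (@nonneg_times R) V.
  move=> A B hA hB; apply: NX => //.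
  suff : sigma_family (@nonneg_times R) V `<=` sigma_family setT X by exact.
  apply: smallest_sub; first exact: smallest_sigma_algebra.
  move=> C' [u u0 [C mC <-]]; rewrite setTI.
  apply: (@family_space_sigma _ _ _ _ _ setT X _ _ (V u)) => //.
  apply: measurable_sum => i; apply: measurable_natr_fun.
  exact: (measurable_family (D := setT)).
have hV s : 0 <= s -> has_mean P (V s) (mu * (Num.truncn s)%:R).
  move=> s0; have := @has_mean_sum _ _ _ P _ (index_enum 'I_(Num.truncn s))
    (fun i w => (X i w)%:R) (fun=> mu) (fun i _ => hX i).
  by rewrite sumr_const card_ord mulr_natr.
pose K (s t : R) : R := (q - mu ^+ 2) * (minn (Num.truncn s) (Num.truncn t))%:R +
  mu ^+ 2 * ((Num.truncn s)%:R * (Num.truncn t)%:R).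
have hK s t : 0 <= s -> 0 <= t -> has_mean P (fun w => V s w * V t w) (K s t).
  move=> s0 t0; rewrite /K -sum_diagonal.
  have := @has_mean_sum _ _ _ P _ (index_enum 'I_(Num.truncn s))
    (fun i w => \sum_(j < Num.truncn t) (X i w)%:R * (X j w)%:R)
    (fun i => \sum_(j < Num.truncn t) (if val i == val j then q else mu ^+ 2)).
  move=> h; have /h : forall i : 'I_(Num.truncn s), i \in index_enum 'I_(Num.truncn s) ->
      has_mean P (fun w => \sum_(j < Num.truncn t) (X i w)%:R * (X j w)%:R)
        (\sum_(j < Num.truncn t) (if val i == val j then q else mu ^+ 2)).
    by move=> i _; apply: has_mean_sum => j _; exact: hXX.
  apply: has_mean_ext => w; rewrite mulr_suml; apply: eq_bigr => i _.
  by rewrite mulr_sumr.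
have mNR t : 0 <= t -> measurable_fun [set: family_space (@nonneg_times R) N]
    (fun w => (N t w)%:R : R).
  by move=> t0; apply: measurable_natr_fun; exact: (measurable_family (D := @nonneg_times R)).
have ME' t w : 0 <= t -> V (N t w)%:R w = (M t w)%:R.
  by move=> t0; rewrite ME// natr_sum /V natrK.
have KE s t w : K (N s w)%:R (N t w)%:R =
    (q - mu ^+ 2) * (minn (N s w) (N t w))%:R + mu ^+ 2 * ((N s w)%:R * (N t w)%:R).
  by rewrite /K !natrK.
have hmin s t : 0 <= s -> 0 <= t ->
    has_mean P (fun w => (minn (N s w) (N t w))%:R) (k%:R * lambda * Num.min s t).
  wlog st : s t / s <= t.
    move=> h s0 t0; have [st|ts] := leP s t; first by have := h _ _ st s0 t0; rewrite min_l.
    have := h _ _ (ltW ts) t0 s0; rewrite min_l ?ltW//; apply: has_mean_ext => w.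
    by rewrite minnC.
  move=> s0 t0; rewrite min_l//; apply: has_mean_ext (poisson_mean rate0 hN s0) => w.
  by rewrite (minn_idPl (N_le _ _ _ s0 st)).
have hKN s t : 0 <= s -> 0 <= t -> has_mean P (fun w => K (N s w)%:R (N t w)%:R)
    (q * (k%:R * lambda) * Num.min s t + (mu * (k%:R * lambda)) ^+ 2 * (s * t)).
  move=> s0 t0; under eq_fun do rewrite KE.
  have := has_meanD (has_meanZ (q - mu ^+ 2) (hmin _ _ s0 t0))
    (has_meanZ (mu ^+ 2) (poisson_product rate0 hN s0 t0)).
  by congr has_mean; ring.
exists (mu * (k%:R * lambda)), (q * (k%:R * lambda)); split.
- exact: mulr_gt0.
- move=> t t0.
  have mMR : measurable_fun setT (fun w => (M t w)%:R : R).
    under eq_fun do rewrite -ME'//.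
    exact: (measurable_subordinated mN mV V_rc (mNR _ t0)).
  move=> _ B mB; rewrite setTI.
  have -> : M t @^-1` B = \bigcup_(n in B) ((fun w => (M t w)%:R : R) @^-1` [set n%:R]).
    apply/seteqP; split=> [w /= Bw|w [n Bn /= /eqP]].
      by exists (M t w).
    by rewrite eqr_nat => /eqP ->.
  apply: bigcup_measurable => n _.
  by rewrite -[X in measurable X]setTI; exact: mMR.
- move=> t w t0; near=> s.
  have s0 : 0 <= s by rewrite (le_trans t0)//; near: s; exact: nbhs_right_ge.
  rewrite !ME//; have -> // : N s w = N t w.
  by near: s; exact: N_rc.
- move=> t t0; have hKt := hKN _ _ t0 t0.
  have hV2 s : 0 <= s -> has_mean P (fun w => V s w ^+ 2) (K s s).
    by move=> s0; apply: has_mean_ext (hK _ _ s0 s0) => w; rewrite expr2.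
  have [c [hc1 hc2]] := has_mean_subordinated mN mV V_rc NV (mNR _ t0)
    (fun=> ler0n _ _) hV hV2 hKt.
  have -> : mu * (k%:R * lambda) * t = c.
    apply: has_mean_unique hc1; under eq_fun do rewrite natrK.
    by rewrite -mulrA; apply: has_meanZ; exact: poisson_mean.
  by apply: has_mean_ext hc2 => w; rewrite ME'.
- move=> s t s0 t0.
  have [c [hc1 hc2]] := has_mean_subordinated_product mN mV V_rc NV (mNR _ s0) (mNR _ t0)
    (fun=> ler0n _ _) (fun=> ler0n _ _) hK (hKN _ _ s0 s0) (hKN _ _ t0 t0).
  rewrite -(has_mean_unique hc1 (hKN _ _ s0 t0)).
  by apply: has_mean_ext hc2 => w; rewrite !ME'.
Unshelve. all: end_near. Qed.

End random_sums.

Lemma SPoK_moments (k : nat) (lambda1 lambda2 : R) (S : R -> T -> R) :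
  (0 < k)%N -> 0 < lambda1 -> 0 < lambda2 -> SPoK P k lambda1 lambda2 S ->
  exists m v : R, [/\ 0 < v,
    (forall t : R, 0 <= t -> measurable_fun setT (S t)),
    (forall (t : R) w, 0 <= t -> S s w @[s --> t^'+] --> S t w),
    (forall t : R, 0 <= t -> has_mean P (S t) (m * t)) &
    (forall s t : R, 0 <= s -> 0 <= t ->
       has_mean P (fun w => S s w * S t w) (v * Num.min s t + m ^+ 2 * (s * t)))].
Proof.
move=> k0 l10 l20 [M1 [M2 [hM1 hM2 M12 SE]]].
have [a1 [b1 [b10 mM1 rc1 h1 hh1]]] := PPoK_moments k0 l10 hM1.
have [a2 [b2 [b20 mM2 rc2 h2 hh2]]] := PPoK_moments k0 l20 hM2.
have h12 s t : 0 <= s -> 0 <= t ->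
    has_mean P (fun w => (M1 s w)%:R * (M2 t w)%:R) (a1 * s * (a2 * t)).
  move=> s0 t0; apply: has_meanM_independent => //; [|exact: h1|exact: h2].
  move=> A B mA mB; apply: M12.
    apply: (@family_space_sigma _ _ _ _ _ _ M1 _ _ (fun w => (M1 s w)%:R : R)) => //.
    by apply: measurable_natr_fun; exact: (measurable_family (D := @nonneg_times R)).
  apply: (@family_space_sigma _ _ _ _ _ _ M2 _ _ (fun w => (M2 t w)%:R : R)) => //.
  by apply: measurable_natr_fun; exact: (measurable_family (D := @nonneg_times R)).
exists (a1 - a2), (b1 + b2); split.
- exact: addr_gt0.
- move=> t t0.
  have -> : S t = (fun w => (M1 t w)%:R - (M2 t w)%:R).
    by apply/funext => w; exact: SE.
  by apply: measurable_funB; apply: measurable_natr_fun; [exact: mM1|exact: mM2].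
- move=> t w t0; apply: cvg_near_cst; near=> s.
  have s0 : 0 <= s by rewrite (le_trans t0)//; near: s; exact: nbhs_right_ge.
  rewrite !SE//; congr (_%:R - _%:R).
    by near: s; exact: rc1.
  by near: s; exact: rc2.
- move=> t t0; rewrite mulrBl.
  by apply: has_mean_ext (has_meanB (h1 _ t0) (h2 _ t0)) => w; rewrite SE.
- move=> s t s0 t0.
  have := has_meanB (has_meanD (hh1 _ _ s0 t0) (hh2 _ _ s0 t0))
    (has_meanD (h12 _ _ s0 t0) (h12 _ _ t0 s0)).
  rewrite [X in has_mean _ _ X](_ : _ =
    (b1 + b2) * Num.min s t + (a1 - a2) ^+ 2 * (s * t)); last by ring.
  by apply: has_mean_ext => w; rewrite !SE//; ring.
Unshelve. all: end_near. Qed.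

End order_k.

(** * Increments and Laplace transforms of subordinators *)

Section subordinator_increments.
Context d (T : measurableType d) (R : realType) (P : probability T R).
Variables (f : R -> R) (D : R -> T -> R).
Hypothesis subD : subordinator P D.

Lemma subordinator_measurable (t : R) : 0 <= t -> measurable_fun setT (D t).
Proof. by case: subD => -[+ _ _ _ _] _ _; exact. Qed.

Lemma subordinator_ge0 w (t : R) : 0 <= t -> 0 <= D t w.
Proof. by case: subD => _ + _; exact. Qed.

Lemma subordinator_le w (s t : R) : 0 <= s -> s <= t -> D s w <= D t w.
Proof. by case: subD => _ _; exact. Qed.

Lemma subordinator0 : {ae P, forall w, D 0 w = 0}.
Proof. by case: subD => -[_ + _ _ _] _ _. Qed.

Lemma measurable_preimageR (X : T -> R) (A : set R) : measurable_fun setT X ->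
  measurable A -> measurable (X @^-1` A).
Proof. by move=> mX mA; have := mX measurableT A mA; rewrite setTI. Qed.

Lemma ae_eq_probability (A B : set T) : measurable A -> measurable B ->
  {ae P, forall w, A w <-> B w} -> P A = P B.
Proof.
move=> mA mB AB.
rewrite -[A]setIT -[B]setIT -!integral_indic//.
apply: ge0_ae_eq_integral => //; try by apply/measurable_EFinP; exact: measurable_indic.
by apply: filterS AB => w ABw _ /=; rewrite !indicE; congr (_%:R%:E);
  congr nat_of_bool; apply/idP/idP; rewrite !inE => /ABw.
Qed.

Lemma subordinator_increment_independent (s t : R) (A B : set R) :
  0 <= s -> s <= t -> measurable A -> measurable B ->
  P (D s @^-1` A `&` (fun w => D t w - D s w) @^-1` B) =
  (P (D s @^-1` A) * P (D (t - s) @^-1` B))%E.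
Proof.
move=> s0 st mA mB.
have t0 : 0 <= t := le_trans s0 st.
have [[_ _ indD statD _] _ _] := subD.
have mDs := subordinator_measurable s0; have mDt := subordinator_measurable t0.
have mD0 := subordinator_measurable (lexx 0).
pose u (n : nat) := if n is n'.+1 then (if n' is 0%N then s else t) else (0 : R).
have indep : independent_rvs P (fun i w => D (u i.+1) w - D (u i) w).
  by apply: indD => //; apply/nondecreasing_seqP => -[|[|n]] /=.
have := independent_rvs_pair (isT : 0%N != 1%N) indep mA mB.
rewrite /u /= => indep01.
have ms : measurable_fun setT (fun w => D s w - D 0 w) by exact: measurable_funB.
have mt : measurable_fun setT (fun w => D t w - D s w) by exact: measurable_funB.
rewrite -(_ : P ((fun w => D s w - D 0 w) @^-1` A) = P (D s @^-1` A)); last first.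
  apply: ae_eq_probability; [exact: measurable_preimageR|exact: measurable_preimageR|].
  by apply: filterS subordinator0 => w /= ->; rewrite subr0.
rewrite -(statD s t B s0 st mB) -indep01; apply: ae_eq_probability.
- by apply: measurableI; exact: measurable_preimageR.
- by apply: measurableI; exact: measurable_preimageR.
- by apply: filterS subordinator0 => w /= ->; rewrite subr0.
Qed.

Hypothesis lapD : laplace_exponent P D f.

Lemma subordinator_laplace (t s : R) : 0 <= t -> 0 < s ->
  has_mean P (fun w => expR (- (s * D t w))) (expR (- (t * f s))).
Proof.
move=> t0 s0; apply: has_mean_ge0.
- apply: measurableT_comp => //; apply: measurableT_comp => //.
  by apply: measurable_funM => //; exact: subordinator_measurable.
- by move=> w; exact: expR_ge0.
- by have := lapD t0 s0; rewrite unlock.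
Qed.

Lemma subordinator_cdf (t x : R) : 0 <= t ->
  P [set w | D t w <= x] = (fine (P [set w | D t w <= x]))%:E /\
  has_mean P (\1_[set w | D t w <= x]) (fine (P [set w | D t w <= x])).
Proof.
move=> t0.
have mE : measurable [set w | D t w <= x].
  rewrite (_ : [set _ | _] = D t @^-1` `]-oo, x]%classic).
    exact: measurable_preimageR (subordinator_measurable t0) _.
  by apply/seteqP; split=> w /=; rewrite in_itv.
have PE : P [set w | D t w <= x] = (fine (P [set w | D t w <= x]))%:E.
  by rewrite fineK// fin_num_measure.
by split=> //; exact: has_mean_indic.
Qed.

Lemma indic_le_exp (y x : R) : 0 < x -> 0 <= y ->
  ((y <= x)%R%:R : R) <= expR 1 * expR (- (x^-1 * y)).
Proof.
move=> x0 y0; rewrite -expRD; have [yx|xy] := leP y x; last exact: expR_ge0.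
rewrite -[leLHS]expR0 ler_expR subr_ge0 mulrC ler_pdivrMr//; lra.
Qed.

Lemma subordinator_cdf_le (t x : R) : 0 <= t -> 0 < x ->
  fine (P [set w | D t w <= x]) <= expR 1 * expR (- (t * f x^-1)).
Proof.
move=> t0 x0; have [_ hE] := subordinator_cdf x t0.
have xV : 0 < x^-1 by rewrite invr_gt0.
apply: (has_mean_le hE (has_meanZ (expR 1) (subordinator_laplace t0 xV))).
apply: aeW => w /=; have := indic_le_exp x0 (subordinator_ge0 w t0).
rewrite indicE; case: (leP (D t w) x) => Dx.
  by rewrite mem_set.
by rewrite memNset//=; apply/negP; rewrite -ltNge.
Qed.

(** By the exponential Chebyshev inequality, P (D_n <= x) decays geometrically
    in n. *)
Lemma subordinator_unbounded : (forall s, 0 < s -> 0 < f s) ->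
  {ae P, forall w, forall x : R, exists n : nat, x < D n%:R w}.
Proof.
move=> f0.
have main (m : nat) : {ae P, forall w, exists n : nat, m.+1%:R < D n%:R w}.
  pose E := \bigcap_n [set w | D n%:R w <= m.+1%:R].
  have mE' n : measurable [set w | D n%:R w <= m.+1%:R].
    rewrite (_ : [set _ | _] = D n%:R @^-1` `]-oo, m.+1%:R]%classic).
      exact: measurable_preimageR (subordinator_measurable (ler0n _ _)) _.
    by apply/seteqP; split=> w /=; rewrite in_itv.
  have mE : measurable E by exact: bigcapT_measurable.
  exists E; split=> //; last first.
    by move=> w /= nD n _ /=; rewrite leNgt; apply/negP => h; apply: nD; exists n.
  have PE : P E = (fine (P E))%:E by rewrite fineK// fin_num_measure.
  have p0 : 0 <= fine (P E) by rewrite fine_ge0.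
  rewrite PE; congr EFin; apply/eqP; rewrite eq_le p0 andbT.
  set p := fine (P E) in PE p0 *; set c := f m.+1%:R^-1.
  have c0 : 0 < c by apply: f0; rewrite invr_gt0.
  have bound n : p * (n%:R * c) <= expR 1.
    have [PD _] := subordinator_cdf m.+1%:R (ler0n R n).
    have h1 : p <= fine (P [set w | D n%:R w <= m.+1%:R]).
      rewrite -lee_fin -PE -PD; apply: le_measure; rewrite ?inE//.
      by move=> w Ew; exact: Ew.
    have h2 := le_trans h1 (subordinator_cdf_le (ler0n R n) (ltr0Sn R m)).
    have h3 : p * expR (n%:R * c) <= expR 1.
      by rewrite -ler_pdivlMr ?expR_gt0// -expRN.
    apply: le_trans h3; apply: ler_wpM2l => //.
    by apply: le_trans (expR_ge1Dx _); rewrite lerDr.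
  rewrite leNgt; apply/negP => p_gt0.
  have := bound (Num.truncn (expR 1 / (p * c))).+1.
  rewrite mulrCA -ler_pdivlMr ?mulr_gt0//.
  by rewrite leNgt truncnS_gt.
have := @ae_foralln _ _ _ P (fun m w => exists n : nat, m.+1%:R < D n%:R w) main.
apply: filterS => w hw x; have [n hn] := hw (Num.truncn x).
by exists n; apply: lt_trans hn; exact: truncnS_gt.
Qed.
End subordinator_increments.

(** * First passage times and counts on a grid *)

Section tail_sums.
Context d (T : measurableType d) (R : realType) (P : probability T R).

(** With a natural number written as the sum of the indicators of i < n, products
    of integer-valued variables become double series of probabilities. *)
Lemma eseries_lt (n : nat) (u : nat -> R) :
  (forall i, 0 <= u i) ->
  (\sum_(i <oo) ((i < n)%N%:R * u i)%:E = (\sum_(i < n) u i)%:E)%E.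
Proof.
move=> u0; rewrite (nneseries_split 0 n) => [|k _]; last by rewrite lee_fin mulr_ge0.
rewrite add0n [X in (_ + X)%E]eseries0 ?adde0; last first.
  by move=> i ni _; rewrite ltnNge ni mul0r.
rewrite big_mkord sumEFin; congr EFin; apply: eq_bigr => i _.
by rewrite ltn_ord mul1r.
Qed.

Lemma sum_pairs (s t : nat) : (s <= t)%N ->
  \sum_(i < s) (t - i)%:R =
  s%:R * t%:R - 2^-1 * (s%:R ^+ 2 - s%:R) :> R.
Proof.
elim: s => [|s IH] st; first by rewrite big_ord0; field.
by rewrite big_ord_recr /= IH 1?ltnW// natrB 1?ltnW// -natr1; field.
Qed.

Lemma measurable_ltn_indic (tau : T -> nat) i : measurable_fun setT tau ->
  measurable_fun setT (fun w => (i < tau w)%N%:R : R).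
Proof.
move=> mtau; apply: measurable_natr_fun.
exact: (measurableT_comp (f := fun n => nat_of_bool (i < n)%N)).
Qed.

Lemma integral_nat_tail (tau : T -> nat) (p : nat -> R) :
  measurable_fun setT tau ->
  (forall i, has_mean P (fun w => (i < tau w)%N%:R) (p i)) ->
  (\int[P]_w ((tau w)%:R)%:E = \sum_(i <oo) (p i)%:E)%E.
Proof.
move=> mtau hp.
transitivity (\int[P]_w \sum_(i <oo) ((i < tau w)%N%:R : R)%:E)%E.
  apply: eq_integral => w _.
  under eq_eseriesr do rewrite -[_%:R]mulr1.
  by rewrite eseries_lt// sumr_const card_ord.
rewrite integral_nneseries//.
- by apply: eq_eseriesr => i _; case: (hp i).
- by move=> i; apply/measurable_EFinP; exact: measurable_ltn_indic.
Qed.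

(** For tau <= sigma, tau sigma - (tau^2 - tau) / 2 is the number of pairs (i, j)
    with i < tau and i <= j < sigma; the pairs are indexed by i and k = j - i, so
    that the increments of a process over the k last steps show up. *)
Lemma integral_nat_pair_tail (tau sigma : T -> nat) (p : nat -> nat -> R) :
  measurable_fun setT tau -> measurable_fun setT sigma ->
  (forall w, (tau w <= sigma w)%N) ->
  (forall i k, has_mean P
     (fun w => (i < tau w)%N%:R * (i + k < sigma w)%N%:R) (p i k)) ->
  (\int[P]_w ((tau w)%:R * (sigma w)%:R - 2^-1 * ((tau w)%:R ^+ 2 - (tau w)%:R))%:E =
   \sum_(i <oo) \sum_(k <oo) (p i k)%:E)%E.
Proof.
move=> mtau msigma le hp.
have mfun i k : measurable_fun setT
    (fun w => ((i < tau w)%N%:R * (i + k < sigma w)%N%:R : R)%:E).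
  by apply/measurable_EFinP/measurable_funM; exact: measurable_ltn_indic.
transitivity (\int[P]_w \sum_(i <oo) \sum_(k <oo)
    ((i < tau w)%N%:R * (i + k < sigma w)%N%:R : R)%:E)%E.
  apply: eq_integral => w _; rewrite -sum_pairs//.
  rewrite -(eseries_lt (tau w) (u := fun i => (sigma w - i)%:R))//.
  apply: eq_eseriesr => i _; under eq_eseriesr do rewrite EFinM.
  rewrite nneseriesZl// EFinM; congr (_ * _)%E.
  under eq_eseriesr => k _ do rewrite -ltn_subRL -[_%:R]mulr1.
  by rewrite eseries_lt// sumr_const card_ord.
rewrite integral_nneseries//.
- apply: eq_eseriesr => i _; rewrite integral_nneseries//.
    by apply: eq_eseriesr => k _; case: (hp i k).
- by move=> i; apply: ge0_emeasurable_sum.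
- by move=> i w _; apply: nneseries_ge0 => k _ _; rewrite lee_fin mulr_ge0.
Qed.

Lemma eseries_geometric_lty (c q : R) : 0 <= c -> 0 <= q < 1 ->
  (\sum_(i <oo) (c * q ^+ i)%:E < +oo)%E.
Proof.
move=> c0 /andP[q0 q1]; apply: le_lt_trans (ltry (c / (1 - q))).
apply: lime_le.
  by apply: is_cvg_nneseries => n _ _; rewrite lee_fin mulr_ge0// exprn_ge0.
apply: nearW => n; rewrite sumEFin lee_fin big_mkord -mulr_sumr ler_wpM2l//.
rewrite -(mulr1 (_^-1)) -ler_pdivrMl ?invr_gt0 ?subr_gt0// invrK.
have := subrX1 q n; have := exprn_ge0 n q0.
set S := \sum_(i < n) _ => qn0 e; nra.
Qed.

End tail_sums.

Section hitting_index.
Context d (T : measurableType d) (R : realType) (P : probability T R).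
Variables (D : R -> T -> R).
Hypothesis subD : subordinator P D.

(** The discrete counterpart of the first passage time; the value 0 for a path
    that never exceeds x agrees with inf set0 = 0. *)
Definition hitting_index (h x : R) (w : T) : nat :=
  if pselect (exists n : nat, x < D (n%:R * h) w) is left e then ex_minn e else 0%N.

Lemma hitting_index_le (h x : R) w i :
  (i < hitting_index h x w)%N -> D (i%:R * h) w <= x.
Proof.
rewrite /hitting_index; case: pselect => // e; case: ex_minnP => m _ min im.
by rewrite leNgt; apply/negP => /min; rewrite leqNgt im.
Qed.

Lemma hitting_index_gt (h x : R) w : (exists n : nat, x < D (n%:R * h) w) ->
  x < D ((hitting_index h x w)%:R * h) w.
Proof. by rewrite /hitting_index; case: pselect => // e _; case: ex_minnP. Qed.

Lemma ltn_hitting_index (h x : R) w i : 0 < h ->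
  (exists n : nat, x < D (n%:R * h) w) ->
  (i < hitting_index h x w)%N = (D (i%:R * h) w <= x).
Proof.
move=> h0 e; apply/idP/idP; first exact: hitting_index_le.
rewrite ltnNge; apply: contraL => hi; rewrite -ltNge.
apply: lt_le_trans (hitting_index_gt e) _; apply: subordinator_le subD _ _ _ _ _.
  by rewrite mulr_ge0// ltW.
by rewrite (ler_wpM2r (ltW h0))// ler_nat.
Qed.

Lemma grid_unbounded (h x y : R) w : 0 < h -> 0 <= y -> x < D y w ->
  exists n : nat, x < D (n%:R * h) w.
Proof.
move=> h0 y0 xy; exists (Num.truncn (y / h)).+1; apply: lt_le_trans xy _.
apply: subordinator_le subD _ _ _ _ _ => //.
by rewrite -ler_pdivrMr// ltW// truncnS_gt.
Qed.

Lemma first_passage_bounds (h x : R) w : 0 < h ->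
  [/\ 0 <= first_passage D x w,
      first_passage D x w <= (hitting_index h x w)%:R * h &
      (hitting_index h x w)%:R * h <= first_passage D x w + h].
Proof.
move=> h0; rewrite /first_passage; set A := [set r | _].
have A_lb : lbound A 0 by move=> r [].
have [e|ne] := pselect (exists n : nat, x < D (n%:R * h) w); last first.
  have A0 : A = set0.
    apply/seteqP; split=> // r [r0 xr]; apply: ne; exact: grid_unbounded xr.
  have -> : hitting_index h x w = 0%N by rewrite /hitting_index; case: pselect.
  by rewrite A0 inf0 mul0r add0r lexx ltW.
set n := hitting_index h x w.
have An : A (n%:R * h) by split; [rewrite mulr_ge0// ltW|exact: hitting_index_gt].
have Ane : nonempty A by exists (n%:R * h).
have inf_ge : 0 <= inf A by exact: lb_le_inf.
split=> //; first by apply: ge_inf => //; exists 0.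
case En : n => [|m]; first by rewrite mul0r addr_ge0// ltW.
rewrite -natr1 mulrDl mul1r lerD2r; apply: lb_le_inf => // r [r0 xr].
rewrite leNgt; apply/negP => rm.
have : D (m%:R * h) w <= x by apply: hitting_index_le; rewrite -/n En.
rewrite leNgt => /negP; apply; apply: lt_le_trans xr _.
exact: subordinator_le subD _ _ _ r0 (ltW rm).
Qed.

Lemma measurable_hitting_index (h x : R) : 0 < h ->
  measurable_fun setT (hitting_index h x).
Proof.
move=> h0.
have mlt i : measurable [set w | (i < hitting_index h x w)%N].
  rewrite (_ : [set _ | _] = (D (i%:R * h) @^-1` `]-oo, x]%classic) `&`
      \bigcup_n (D (n%:R * h) @^-1` `]x, +oo[%classic)); last first.
    apply/seteqP; split=> w /=; rewrite in_itv /=.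
      move=> hi; split; first exact: hitting_index_le hi.
      have [[n xn]|ne] := pselect (exists n : nat, x < D (n%:R * h) w).
        by exists n => //=; rewrite in_itv /= andbT.
      by move: hi; rewrite /hitting_index; case: pselect.
    move=> [Dx [n _ /=]]; rewrite in_itv /= andbT => xn.
    by rewrite ltn_hitting_index//; exists n.
  have mD n : measurable_fun setT (D (n%:R * h)).
    by apply: (subordinator_measurable subD); rewrite mulr_ge0// ltW.
  apply: measurableI; first exact: measurable_preimageR.
  by apply: bigcupT_measurable => n; exact: measurable_preimageR.
move=> _; apply: (measurability _ NGenCInfty.measurableE) => // _ [_ [a ->] <-].
rewrite setTI; case: a => [|i].
  by rewrite (_ : _ @^-1` _ = setT)//; apply/seteqP; split=> // w _ /=.
by have := mlt i; congr (measurable _); apply/seteqP; split=> w /=;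
  rewrite in_itv /= andbT.
Qed.

(** The infimum ranges over uncountably many times; its approximations on grids
    only involve countably many variables of the process. *)
Lemma measurable_first_passage (x : R) : measurable_fun setT (first_passage D x).
Proof.
apply: (@measurable_fun_cvg _ _ _ _
  (fun n w => (hitting_index n.+1%:R^-1 x w)%:R * n.+1%:R^-1)).
  move=> n; apply: measurable_funM => //; apply: measurable_natr_fun.
  by apply: measurable_hitting_index; rewrite invr_gt0.
move=> w _; apply: (@squeeze_cvgr _ _ _ _ (fun=> first_passage D x w)
  (fun n => first_passage D x w + n.+1%:R^-1)).
- apply: nearW => n.
  have n0 : 0 < n.+1%:R^-1 :> R by rewrite invr_gt0.
  by have [_ -> ->] := first_passage_bounds x w n0.
- exact: cvg_cst.
- rewrite -[X in _ --> X]addr0; apply: cvgD; first exact: cvg_cst.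
  exact: cvg_harmonic.
Qed.

Lemma first_passage_ge0 (x : R) w : 0 <= first_passage D x w.
Proof. by have [] := first_passage_bounds x w (@ltr01 R). Qed.

End hitting_index.

(** * Moments of the inverse stable subordinator *)

Section power_increments.
Context (R : realType).
Implicit Types (a x y alpha : R).

Lemma powR_antitone x y r : 0 < x -> x <= y -> r <= 0 -> y `^ r <= x `^ r.
Proof.
move=> x0 xy r0; have y0 := lt_le_trans x0 xy.
rewrite -[r]opprK powRN [leRHS]powRN lef_pV2 ?posrE ?powR_gt0//.
by apply: ge0_ler_powR; rewrite ?oppr_ge0// nnegrE ltW.
Qed.

Lemma powR_increment_le a x alpha : 0 <= a -> 0 < x -> 0 < alpha <= 1 ->
  (x + a) `^ alpha - x `^ alpha <= a * x `^ (alpha - 1).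
Proof.
move=> a0 x0 /andP[al0 al1]; have xa0 : 0 < x + a by rewrite ltr_wpDr.
rewrite lerBlDl -(mulr_powRB1 (ltW xa0) al0) -(mulr_powRB1 (ltW x0) al0) -mulrDl.
apply: ler_wpM2l; first exact: ltW.
apply: powR_antitone => //; first by rewrite lerDl.
by rewrite subr_le0.
Qed.

Lemma powR_subadditive a x alpha : 0 <= a -> 0 <= x -> 0 < alpha <= 1 ->
  (x + a) `^ alpha <= x `^ alpha + a `^ alpha.
Proof.
move=> a0 x0 /andP[al0 al1].
move: a0; rewrite le_eqVlt => /orP[/eqP <-|a0].
  by rewrite addr0 powR0 ?addr0// gt_eqF.
move: x0; rewrite le_eqVlt => /orP[/eqP <-|x0].
  by rewrite add0r powR0 ?add0r// gt_eqF.
have xa0 : 0 < x + a by rewrite addr_gt0.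
rewrite -(mulr_powRB1 (ltW xa0) al0) -(mulr_powRB1 (ltW x0) al0).
rewrite -(mulr_powRB1 (ltW a0) al0) mulrDl.
have al : alpha - 1 <= 0 by rewrite subr_le0.
apply: lerD; apply: ler_wpM2l; try exact: ltW; apply: powR_antitone => //.
  by rewrite lerDl ltW.
by rewrite lerDr ltW.
Qed.

(** An increment over a step of length a is at most a `^ alpha, and it is small
    if the step starts beyond L; the exponential stands for the indicator of
    x <= L and has the advantage that its mean is known. *)
Lemma powR_increment_exp_le a x L alpha : 0 <= a -> 0 <= x -> 0 < L ->
  0 < alpha <= 1 ->
  (x + a) `^ alpha - x `^ alpha <=
  a `^ alpha * (expR 1 * expR (- (L^-1 * x))) + a * L `^ (alpha - 1).
Proof.
move=> a0 x0 L0 al; have /andP[al0 al1] := al.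
have := indic_le_exp L0 x0.
have [xL|Lx] := leP x L => h.
  apply: (@le_trans _ _ (a `^ alpha)).
    by rewrite lerBlDl powR_subadditive.
  apply: (@le_trans _ _ (a `^ alpha * (expR 1 * expR (- (L^-1 * x))))).
    by rewrite ler_peMr// powR_ge0.
  by rewrite lerDl mulr_ge0// powR_ge0.
apply: (@le_trans _ _ (a * x `^ (alpha - 1))).
  by apply: powR_increment_le => //; exact: lt_trans Lx.
apply: (@le_trans _ _ (a * L `^ (alpha - 1))).
  by rewrite ler_wpM2l//; apply: powR_antitone => //; [exact: ltW|rewrite subr_le0].
by rewrite lerDr !mulr_ge0// ?powR_ge0 ?expR_ge0.
Qed.

Lemma ler_limit_scale (x y c : R) : 0 <= c ->
  (forall h, 0 < h -> h <= 1 -> x <= y + h * c) -> x <= y.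
Proof.
move=> c0 H; apply/ler_addgt0Pr => e e0.
pose h := Num.min 1 (e / (c + 1)).
have c1 : 0 < c + 1 by rewrite ltr_wpDl.
have h0 : 0 < h by rewrite lt_min ltr01 divr_gt0.
apply: le_trans (H h h0 _) _; first by rewrite ge_min lexx.
rewrite lerD2l; apply: (@le_trans _ _ (e / (c + 1) * c)).
  by rewrite ler_wpM2r// ge_min lexx orbT.
rewrite mulrAC ler_pdivrMr// ler_wpM2l ?ltW// ltrDl//.
Qed.

End power_increments.

Section inverse_stable.
Context d (T : measurableType d) (R : realType) (P : probability T R).
Variables (alpha : R) (D : R -> T -> R).
Hypotheses (halpha : 0 < alpha < 1) (hD : stable_subordinator P alpha D).

Let subD : subordinator P D. Proof. by case: hD. Qed.
Let lapD : laplace_exponent P D (fun s => s `^ alpha). Proof. by case: hD. Qed.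
Let alpha0 : 0 < alpha. Proof. by case/andP: halpha. Qed.
Let f0 s : 0 < s -> 0 < s `^ alpha. Proof. exact: powR_gt0. Qed.
Let mD (t : R) : 0 <= t -> measurable_fun setT (D t).
Proof. by move=> t0; exact: (subordinator_measurable subD). Qed.

Local Notation tau := (hitting_index D).
Local Notation Y := (first_passage D).
Local Notation p t x := (fine (P [set w | D t w <= x])).

Let p_ge0 t x : 0 <= p t x. Proof. exact: fine_ge0. Qed.

Let mle (t x : R) : 0 <= t -> measurable [set w | D t w <= x].
Proof.
move=> t0; rewrite (_ : [set _ | _] = D t @^-1` `]-oo, x]%classic).
  exact: measurable_preimageR (mD t0) _.
by apply/seteqP; split=> w /=; rewrite in_itv.
Qed.

Let unbounded (h x : R) : 0 < h -> {ae P, forall w, exists n : nat, x < D (n%:R * h) w}.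
Proof.
move=> h0; apply: filterS (subordinator_unbounded subD lapD f0) => w hw.
have [n xn] := hw x; exact: (grid_unbounded subD h0 (ler0n _ n) xn).
Qed.

Let grid0 (h : R) (i : nat) : 0 < h -> 0 <= i%:R * h.
Proof. by move=> h0; rewrite mulr_ge0// ltW. Qed.

Lemma first_passage_ae_le (x y : R) : x <= y -> {ae P, forall w, Y x w <= Y y w}.
Proof.
move=> xy; apply: filterS (unbounded y (@ltr01 R)) => w [n yn].
apply: lb_le_inf; first by exists (n%:R * 1); split => //; rewrite mulr1.
move=> r [r0 yr]; apply: ge_inf; first by exists 0 => z [].
by split=> //; exact: le_lt_trans yr.
Qed.

Let has_mean_tail (h x : R) i : 0 < h ->
  has_mean P (fun w => (i < tau h x w)%N%:R) (p (i%:R * h) x).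
Proof.
move=> h0; have [_ hE] := subordinator_cdf subD x (grid0 i h0).
apply: has_mean_ae hE.
  by apply: measurable_ltn_indic; exact: (measurable_hitting_index subD).
apply: filterS (unbounded x h0) => w e.
rewrite (ltn_hitting_index subD _ h0 e) indicE; congr (nat_of_bool _)%:R.
by apply/idP/idP; rewrite inE.
Qed.

Let p_le (t x y : R) : 0 <= t -> x <= y -> p t x <= p t y.
Proof.
move=> t0 xy; have [_ hx] := subordinator_cdf subD x t0.
have [_ hy] := subordinator_cdf subD y t0.
apply: (has_mean_le hx hy); apply: aeW => w; rewrite !indicE ler_nat.
have [/set_mem /= h|//] := boolP (w \in [set w | D t w <= x]).
by rewrite mem_set//=; exact: le_trans xy.
Qed.

Let series_p_lty (h x : R) : 0 < h -> (\sum_(i <oo) (p (i%:R * h) x)%:E < +oo)%E.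
Proof.
move=> h0; pose x' := Num.max x 1.
have x'0 : 0 < x' by rewrite lt_max ltr01 orbT.
pose q := expR (- (h * (x'^-1) `^ alpha)).
have q1 : q < 1 by rewrite -expR0 ltr_expR oppr_lt0 mulr_gt0// f0// invr_gt0.
apply: le_lt_trans (@eseries_geometric_lty _ (expR 1) q _ _); last 2 first.
- exact: expR_ge0.
- by rewrite expR_ge0.
apply: lee_nneseries => [i _ _|i _]; first by rewrite lee_fin.
rewrite lee_fin; apply: le_trans (p_le (grid0 i h0) (_ : x <= x')) _.
  by rewrite le_max lexx.
apply: le_trans (subordinator_cdf_le subD lapD (grid0 i h0) x'0) _.
rewrite ler_wpM2l ?expR_ge0//.
by rewrite /q -expRM_natl -mulrA mulrN.
Qed.

Let m1 (h x : R) : R := fine (\sum_(i <oo) (p (i%:R * h) x)%:E).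

Let m1E (h x : R) : 0 < h -> (\sum_(i <oo) (p (i%:R * h) x)%:E = (m1 h x)%:E)%E.
Proof.
move=> h0; rewrite fineK// ge0_fin_numE ?series_p_lty//.
by apply: nneseries_ge0 => i _ _; rewrite lee_fin.
Qed.

Let has_mean_tau (h x : R) : 0 < h -> has_mean P (fun w => (tau h x w)%:R) (m1 h x).
Proof.
move=> h0; have mtau := measurable_hitting_index subD x h0.
apply: has_mean_ge0 => //; first exact: measurable_natr_fun.
rewrite (integral_nat_tail mtau (fun i => has_mean_tail x i h0)).
exact: m1E.
Qed.

(** The joint probabilities that govern the mean of the product of the hitting
    indices of a and b. *)
Let pj (h a b : R) (i k : nat) : R :=
  fine (P ([set w | D (i%:R * h) w <= a] `&` [set w | D ((i + k)%:R * h) w <= b])).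

Let pj_ge0 (h a b : R) i k : 0 <= pj h a b i k. Proof. exact: fine_ge0. Qed.

Let has_mean_pj (h a b : R) i k : 0 < h ->
  has_mean P (\1_([set w | D (i%:R * h) w <= a] `&` [set w | D ((i + k)%:R * h) w <= b]))
    (pj h a b i k).
Proof.
move=> h0; have mI : measurable ([set w | D (i%:R * h) w <= a] `&`
    [set w | D ((i + k)%:R * h) w <= b]).
  by apply: measurableI; apply: mle; exact: grid0.
by apply: has_mean_indic => //; rewrite fineK// fin_num_measure.
Qed.

(** Independence and stationarity of the increments enter the study of the
    inverse process here, and nowhere else. *)
Let increment_product (h a c : R) i k : 0 < h ->
  P ([set w | D (i%:R * h) w <= a] `&`
     [set w | D ((i + k)%:R * h) w - D (i%:R * h) w <= c]) =
  (p (i%:R * h) a * p (k%:R * h) c)%:E.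
Proof.
move=> h0; have le_ik : i%:R * h <= (i + k)%:R * h.
  by rewrite (ler_wpM2r (ltW h0))// ler_nat leq_addr.
have := subordinator_increment_independent subD (grid0 i h0) le_ik
  (measurable_itv `]-oo, a]) (measurable_itv `]-oo, c]).
have -> : (i + k)%:R * h - i%:R * h = k%:R * h by rewrite natrD; ring.
have E (Z : T -> R) z : Z @^-1` `]-oo, z]%classic = [set w | Z w <= z].
  by apply/seteqP; split=> w /=; rewrite in_itv.
rewrite !E => ->; rewrite EFinM !fineK// fin_num_measure//; apply: mle; exact: grid0.
Qed.

Let mle_inc (h c : R) i k : 0 < h ->
  measurable [set w | D ((i + k)%:R * h) w - D (i%:R * h) w <= c].
Proof.
move=> h0; rewrite (_ : [set _ | _] =
    (fun w => D ((i + k)%:R * h) w - D (i%:R * h) w) @^-1` `]-oo, c]%classic).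
  by apply: measurable_preimageR => //; apply: measurable_funB; exact/mD/grid0.
by apply/seteqP; split=> w /=; rewrite in_itv.
Qed.

(** For a <= b, the event D_s <= a, D_t <= b is squeezed between the events in
    which the condition on D_t is replaced by D_t - D_s <= b - a and by
    D_t - D_s <= b. *)
Let pj_le (h a b : R) i k : 0 < h -> pj h a b i k <= p (i%:R * h) a * p (k%:R * h) b.
Proof.
move=> h0; rewrite -lee_fin -increment_product// fineK ?fin_num_measure//; last first.
  by apply: measurableI; apply: mle; exact: grid0.
apply: le_measure; rewrite ?inE.
- by apply: measurableI; apply: mle; exact: grid0.
- by apply: measurableI; [apply: mle; exact: grid0|exact: mle_inc].
- move=> w [/= h1 h2]; split => //=; apply: le_trans h2.
  by rewrite gerBl; exact: (subordinator_ge0 subD _ (grid0 i h0)).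
Qed.

Let pj_ge (h a b : R) i k : 0 < h -> p (i%:R * h) a * p (k%:R * h) (b - a) <= pj h a b i k.
Proof.
move=> h0; rewrite -lee_fin -increment_product// fineK ?fin_num_measure//; last first.
  by apply: measurableI; apply: mle; exact: grid0.
apply: le_measure; rewrite ?inE.
- by apply: measurableI; [apply: mle; exact: grid0|exact: mle_inc].
- by apply: measurableI; apply: mle; exact: grid0.
- by move=> w [/= h1 h2]; split => //=; lra.
Qed.

Let series_product (h a b : R) : 0 < h ->
  (\sum_(i <oo) \sum_(k <oo) (p (i%:R * h) a * p (k%:R * h) b)%:E =
   (m1 h a * m1 h b)%:E)%E.
Proof.
move=> h0; under eq_eseriesr => i _.
  under eq_eseriesr => k _ do rewrite EFinM.
  rewrite nneseriesZl; last by move=> k _; rewrite lee_fin.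
  rewrite m1E// muleC; over.
rewrite /= nneseriesZl; last by move=> k _; rewrite lee_fin.
by rewrite m1E// -EFinM mulrC.
Qed.

(** The mean number of pairs (i, j) with i <= j, D <= a at the grid point i and
    D <= b at the grid point j. *)
Let wv (h a b : R) : R := fine (\sum_(i <oo) \sum_(k <oo) (pj h a b i k)%:E).

Let inner_ge0 (h a b : R) i : (0 <= \sum_(k <oo) (pj h a b i k)%:E)%E.
Proof. by apply: nneseries_ge0 => k _ _; rewrite lee_fin. Qed.

Let wvE (h a b : R) : 0 < h ->
  (\sum_(i <oo) \sum_(k <oo) (pj h a b i k)%:E = (wv h a b)%:E)%E /\
  m1 h a * m1 h (b - a) <= wv h a b <= m1 h a * m1 h b.
Proof.
move=> h0.
have le_up : (\sum_(i <oo) \sum_(k <oo) (pj h a b i k)%:E <= (m1 h a * m1 h b)%:E)%E.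
  rewrite -series_product//; apply: lee_nneseries => [i _ _|i _]; first exact: inner_ge0.
  apply: lee_nneseries => [k _ _|k _]; rewrite lee_fin//; exact: pj_le.
have fin : (\sum_(i <oo) \sum_(k <oo) (pj h a b i k)%:E = (wv h a b)%:E)%E.
  rewrite fineK// ge0_fin_numE; first by apply: le_lt_trans le_up _; exact: ltry.
  by apply: nneseries_ge0 => i _ _; exact: inner_ge0.
split=> //; rewrite -!lee_fin -fin le_up andbT -series_product//.
apply: lee_nneseries => [i _ _|i _].
  by apply: nneseries_ge0 => k _ _; rewrite lee_fin mulr_ge0.
apply: lee_nneseries => [k _ _|k _]; rewrite lee_fin ?mulr_ge0//; exact: pj_ge.
Qed.

Let has_mean_wv (h a b : R) : 0 < h -> a <= b ->
  has_mean P (fun w => (tau h a w)%:R * (tau h b w)%:R -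
    2^-1 * ((tau h a w)%:R ^+ 2 - (tau h a w)%:R)) (wv h a b).
Proof.
move=> h0 ab.
have mta := measurable_hitting_index subD a h0.
have mtb := measurable_hitting_index subD b h0.
pose sigma w := maxn (tau h a w) (tau h b w).
have msigma : measurable_fun setT sigma by exact: measurable_fun_maxn.
have sigmaE : {ae P, forall w, sigma w = tau h b w}.
  apply: filterS2 (unbounded a h0) (unbounded b h0) => w ea eb.
  apply/maxn_idPr; rewrite leqNgt (ltn_hitting_index subD _ h0 ea) -ltNge.
  exact: le_lt_trans ab (hitting_index_gt eb).
have mexpr (s t : T -> nat) : measurable_fun setT s -> measurable_fun setT t ->
    measurable_fun setT (fun w => (s w)%:R * (t w)%:R -
      2^-1 * ((s w)%:R ^+ 2 - (s w)%:R) : R).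
  move=> ms mt; have msR := measurable_natr_fun (R := R) ms.
  have mtR := measurable_natr_fun (R := R) mt.
  apply: measurable_funB; first exact: measurable_funM.
  by apply: measurable_funM => //; apply: measurable_funB => //; exact: measurable_funX.
have hpj i k : has_mean P (fun w => (i < tau h a w)%N%:R * (i + k < sigma w)%N%:R)
    (pj h a b i k).
  apply: has_mean_ae (has_mean_pj a b i k h0).
    by apply: measurable_funM; exact: measurable_ltn_indic.
  apply: filterS3 sigmaE (unbounded a h0) (unbounded b h0) => w -> ea eb.
  rewrite (ltn_hitting_index subD _ h0 ea) (ltn_hitting_index subD _ h0 eb) -natrM mulnb.
  rewrite indicE; congr (nat_of_bool _)%:R.
  by rewrite in_setI; congr (_ && _); apply/idP/idP; rewrite inE.
apply: (@has_mean_ae _ _ _ _ (fun w => (tau h a w)%:R * (sigma w)%:R -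
    2^-1 * ((tau h a w)%:R ^+ 2 - (tau h a w)%:R))).
- exact: mexpr.
- by apply: filterS sigmaE => w ->.
apply: has_mean_ge0.
- exact: mexpr.
- by move=> w; rewrite -sum_pairs ?leq_maxl// sumr_ge0.
rewrite (integral_nat_pair_tail mta msigma (fun w => leq_maxl _ _) hpj).
by have [] := wvE a b h0.
Qed.

Let has_mean_tau2 (h x : R) : 0 < h ->
  has_mean P (fun w => (tau h x w)%:R ^+ 2) (2 * wv h x x - m1 h x).
Proof.
move=> h0; have := has_meanB (has_meanZ 2 (has_mean_wv h0 (lexx x))) (has_mean_tau x h0).
by apply: has_mean_ext => w; field.
Qed.

Let has_mean_tau_product (h a b : R) : 0 < h -> a <= b ->
  has_mean P (fun w => (tau h a w)%:R * (tau h b w)%:R)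
    (wv h a b + wv h a a - m1 h a).
Proof.
move=> h0 ab; have := has_meanD (has_mean_wv h0 ab)
  (has_meanZ 2^-1 (has_meanB (has_mean_tau2 a h0) (has_mean_tau a h0))).
rewrite [X in has_mean _ _ X](_ : _ = wv h a b + wv h a a - m1 h a); last by field.
by apply: has_mean_ext => w; ring.
Qed.

Let mY (x : R) : measurable_fun setT (Y x).
Proof. exact: (measurable_first_passage subD). Qed.

Let Y_bounds (h x : R) w : 0 < h ->
  [/\ 0 <= Y x w, Y x w <= (tau h x w)%:R * h & (tau h x w)%:R * h <= Y x w + h].
Proof. by move=> h0; exact: (first_passage_bounds subD). Qed.

Let u (x : R) : R := fine (\int[P]_w (Y x w)%:E)%E.
Let YY (x y : R) : R := fine (\int[P]_w (Y x w * Y y w)%:E)%E.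

Let has_mean_Y (x : R) : has_mean P (Y x) (u x).
Proof.
have [|a ha] := @has_mean_dominated _ _ _ P (Y x) _ _ (mY x) (has_mean_tau x ltr01).
  apply: aeW => w; have [Y0 Yt _] := Y_bounds x w ltr01.
  by rewrite ger0_norm// -[leRHS]mulr1.
by rewrite /u; have [_ ->] := ha.
Qed.

Let has_mean_YY_le (x y : R) : x <= y -> has_mean P (fun w => Y x w * Y y w) (YY x y).
Proof.
move=> xy; have mYY : measurable_fun setT (fun w => Y x w * Y y w).
  exact: measurable_funM.
have [|a ha] := has_mean_dominated mYY (has_mean_tau_product ltr01 xy).
  apply: aeW => w; have [Y0 Yt _] := Y_bounds x w ltr01.
  have [Z0 Zt _] := Y_bounds y w ltr01; rewrite mulr1 in Yt; rewrite mulr1 in Zt.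
  by rewrite ger0_norm ?mulr_ge0// ler_pM.
by rewrite /YY; have [_ ->] := ha.
Qed.

Let YYC (x y : R) : YY x y = YY y x.
Proof. by rewrite /YY; congr fine; apply: eq_integral => w _; rewrite mulrC. Qed.

Let has_mean_YY (x y : R) : has_mean P (fun w => Y x w * Y y w) (YY x y).
Proof.
have [xy|yx] := leP x y; first exact: has_mean_YY_le.
rewrite YYC; apply: has_mean_ext (has_mean_YY_le (ltW yx)) => w; exact: mulrC.
Qed.

Let u_ge0 (x : R) : 0 <= u x.
Proof.
by apply: has_mean_ge0_le (has_mean_Y x) _; apply: aeW => w; exact: (first_passage_ge0 subD).
Qed.

Let m1_bounds (h x : R) : 0 < h -> u x <= h * m1 h x <= u x + h.
Proof.
move=> h0; have ht := has_meanZ h (has_mean_tau x h0); apply/andP; split.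
  apply: (has_mean_le (has_mean_Y x) ht); apply: aeW => w.
  by have [_ + _] := Y_bounds x w h0; rewrite mulrC.
apply: (has_mean_le ht (has_meanD (has_mean_Y x) (has_mean_cst P h))); apply: aeW => w.
by have [_ _] := Y_bounds x w h0; rewrite mulrC.
Qed.

Let YY_bounds (h a b : R) : 0 < h -> a <= b ->
  YY a b <= h ^+ 2 * (wv h a b + wv h a a - m1 h a) <= YY a b + h * (u a + u b) + h ^+ 2.
Proof.
move=> h0 ab; have ht := has_meanZ (h ^+ 2) (has_mean_tau_product h0 ab).
have E w : h ^+ 2 * ((tau h a w)%:R * (tau h b w)%:R) =
    ((tau h a w)%:R * h) * ((tau h b w)%:R * h) by ring.
apply/andP; split.
  apply: (has_mean_le (has_mean_YY a b) ht); apply: aeW => w.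
  have [Y0 Yt _] := Y_bounds a w h0; have [Z0 Zt _] := Y_bounds b w h0.
  by rewrite E ler_pM//.
have hu := has_meanD (has_meanD (has_mean_YY a b)
  (has_meanZ h (has_meanD (has_mean_Y a) (has_mean_Y b)))) (has_mean_cst P (h ^+ 2)).
apply: (has_mean_le ht hu); apply: aeW => w.
have [Y0 Yt Yh] := Y_bounds a w h0; have [Z0 Zt Zh] := Y_bounds b w h0.
rewrite E; apply: le_trans (ler_pM _ _ Yh Zh) _; rewrite ?mulr_ge0 ?(ltW h0)//.
rewrite le_eqVlt; apply/orP; left; apply/eqP; ring.
Qed.

(** Self-similarity: both variables have Laplace transform
    expR (- (r * s `^ alpha)). *)
Let scaled_cdf (l r x : R) : 0 < l -> 0 <= r ->
  P [set w | D (r * l `^ alpha) w <= l * x] = P [set w | D r w <= x].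
Proof.
move=> l0 r0; have lr0 : 0 <= r * l `^ alpha by rewrite mulr_ge0// powR_ge0.
have -> : [set w | D (r * l `^ alpha) w <= l * x] =
    [set w | l^-1 * D (r * l `^ alpha) w <= x].
  by apply/seteqP; split=> w /=; rewrite -ler_pdivrMl ?invr_gt0// invrK.
apply: (laplace_uniqueness (X := fun w => l^-1 * D (r * l `^ alpha) w)).
- by apply: measurable_funM => //; exact: mD.
- exact: mD.
- move=> w; rewrite mulr_ge0 ?invr_ge0 ?(ltW l0)//; exact: (subordinator_ge0 subD _ lr0).
- move=> w; exact: (subordinator_ge0 subD _ r0).
- move=> n; exists (expR (- (r * n.+1%:R `^ alpha))); split.
    have n0 : 0 < n.+1%:R / l by rewrite divr_gt0.
    have := subordinator_laplace subD lapD lr0 n0.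
    rewrite -mulrA -powRM ?(ltW n0) ?(ltW l0)// [l * _]mulrC divfK ?gt_eqF//.
    by apply: has_mean_ext => w; rewrite mulrA.
  exact: (subordinator_laplace subD lapD r0 (ltr0Sn R n)).
Qed.

Let m1_scale (l h x : R) : 0 < l -> 0 < h -> m1 (h * l `^ alpha) (l * x) = m1 h x.
Proof.
move=> l0 h0; rewrite /m1; congr fine; apply: eq_eseriesr => i _.
by rewrite mulrA scaled_cdf// mulr_ge0// ltW.
Qed.

Let pj_diag (h x : R) i k : 0 < h -> pj h x x i k = p ((i + k)%:R * h) x.
Proof.
move=> h0; rewrite /pj; congr (fine (P _)); apply/seteqP; split=> w /=; first by case.
move=> Dx; split=> //; apply: le_trans Dx.
apply: (subordinator_le subD) => //; first exact: grid0.
by rewrite (ler_wpM2r (ltW h0))// ler_nat leq_addr.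
Qed.

Let wv_scale (l h x : R) : 0 < l -> 0 < h ->
  wv (h * l `^ alpha) (l * x) (l * x) = wv h x x.
Proof.
move=> l0 h0; rewrite /wv; congr fine; apply: eq_eseriesr => i _.
apply: eq_eseriesr => k _; rewrite !pj_diag ?mulr_gt0 ?powR_gt0//.
by rewrite mulrA scaled_cdf// mulr_ge0// ltW.
Qed.

Let u_scale_le (l x : R) : 0 < l -> u (l * x) <= l `^ alpha * u x.
Proof.
move=> l0; have la0 := f0 l0.
apply: (ler_limit_scale (ltW la0)) => h h0 _.
have hl : 0 < h * l `^ alpha by rewrite mulr_gt0.
have /andP[h1 _] := m1_bounds (l * x) hl; have /andP[_ h2] := m1_bounds x h0.
rewrite m1_scale// in h1; apply: le_trans h1 _.
by rewrite [h * l `^ alpha]mulrC -mulrA -mulrDr (ler_wpM2l (ltW la0)).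
Qed.

Let YY_scale_le (l x : R) : 0 < l ->
  YY (l * x) (l * x) <= (l `^ alpha) ^+ 2 * YY x x.
Proof.
move=> l0; have la0 := f0 l0; have la2 : 0 < (l `^ alpha) ^+ 2 by rewrite exprn_gt0.
have c0 : 0 <= (l `^ alpha) ^+ 2 * (2 * u x + 1).
  by rewrite mulr_ge0 ?(ltW la2)// addr_ge0// mulr_ge0.
apply: (ler_limit_scale c0) => h h0 h1.
have hl : 0 < h * l `^ alpha by rewrite mulr_gt0.
have /andP[e1 _] := YY_bounds hl (lexx (l * x)); have /andP[_ e2] := YY_bounds h0 (lexx x).
rewrite m1_scale// wv_scale// in e1; apply: le_trans e1 _.
set z := wv h x x + wv h x x - m1 h x in e2 *.
have -> : (h * l `^ alpha) ^+ 2 * z = (l `^ alpha) ^+ 2 * (h ^+ 2 * z) by ring.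
have -> : (l `^ alpha) ^+ 2 * YY x x + h * ((l `^ alpha) ^+ 2 * (2 * u x + 1)) =
  (l `^ alpha) ^+ 2 * (YY x x + h * (u x + u x) + h) by ring.
rewrite (ler_wpM2l (ltW la2))//; apply: le_trans e2 _; rewrite lerD2l expr2.
by rewrite ler_piMr// ltW.
Qed.

Let powR_invK (l : R) : 0 < l -> l `^ alpha * (l^-1) `^ alpha = 1.
Proof.
by move=> l0; rewrite -powRM ?invr_ge0 ?(ltW l0)// mulfV ?gt_eqF// powR1.
Qed.

Let u_scale (l x : R) : 0 < l -> u (l * x) = l `^ alpha * u x.
Proof.
move=> l0; apply/eqP; rewrite eq_le u_scale_le//=.
have lV : 0 < l^-1 by rewrite invr_gt0.
have := u_scale_le (l * x) lV; rewrite mulKf ?gt_eqF// => h.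
by rewrite -[leRHS]mul1r -(powR_invK l0) -mulrA (ler_wpM2l (ltW (f0 l0))).
Qed.

Let YY_scale (l x : R) : 0 < l -> YY (l * x) (l * x) = (l `^ alpha) ^+ 2 * YY x x.
Proof.
move=> l0; apply/eqP; rewrite eq_le YY_scale_le//=.
have lV : 0 < l^-1 by rewrite invr_gt0.
have := YY_scale_le (l * x) lV; rewrite mulKf ?gt_eqF// => h.
have e : (l `^ alpha) ^+ 2 * ((l^-1) `^ alpha) ^+ 2 = 1.
  by rewrite -exprMn powR_invK// expr1n.
by rewrite -[leRHS]mul1r -e -mulrA; apply: ler_wpM2l => //; exact: sqr_ge0.
Qed.

Let pow2_neq1 : 2 `^ alpha != 1 :> R.
Proof. by rewrite powR_eq1 !negb_or -leNgt ler0n (gt_eqF alpha0) (eqr_nat R 2 1). Qed.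

(** The value 0 is not reached by scaling 1; there, self-similarity with the
    factor 2 forces u 0 = 0. *)
Let uE (x : R) : 0 <= x -> u x = u 1 * x `^ alpha.
Proof.
rewrite le_eqVlt => /orP[/eqP <-|x0]; last by rewrite -{1}[x]mulr1 u_scale// mulrC.
rewrite powR0 ?gt_eqF// mulr0.
have := u_scale 0 (ltr0Sn R 1); rewrite mulr0 => /eqP.
rewrite -subr_eq0 -{1}[u 0]mul1r -mulrBl mulf_eq0 subr_eq0 eq_sym (negbTE pow2_neq1).
by move=> /eqP.
Qed.

Let YYE (x : R) : 0 <= x -> YY x x = YY 1 1 * x `^ (2 * alpha).
Proof.
rewrite [2 * alpha]mulrC powRrM powR_mulrn ?powR_ge0//.
rewrite le_eqVlt => /orP[/eqP <-|x0]; last by rewrite -{1 2}[x]mulr1 YY_scale// mulrC.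
rewrite powR0 ?gt_eqF// expr0n mulr0.
have := YY_scale 0 (ltr0Sn R 1); rewrite mulr0 => /eqP.
rewrite -subr_eq0 -{1}[YY 0 0]mul1r -mulrBl mulf_eq0 subr_eq0 eq_sym sqrf_eq1.
rewrite (negbTE pow2_neq1) => /orP[/eqP h|/eqP//].
by have := f0 (ltr0Sn R 1); rewrite h ltr0N1.
Qed.

(** The bounds on the pair counts pass to the limit h --> 0. *)
Let YY_upper (a b : R) : 0 <= a -> a <= b -> YY a b <= u a * u b + 2^-1 * YY a a.
Proof.
move=> a0 ab; have b0 := le_trans a0 ab.
apply: (@ler_limit_scale _ _ _ (2 * u a + u b + 2)).
  by rewrite !addr_ge0// mulr_ge0.
move=> h h0 h1.
have /andP[e1 _] := YY_bounds h0 ab; have /andP[_ e2] := YY_bounds h0 (lexx a).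
have [_ /andP[_ e3]] := wvE a b h0.
have /andP[a1 a2] := m1_bounds a h0; have /andP[b1 b2] := m1_bounds b h0.
have e4 : (h * m1 h a) * (h * m1 h b) <= (u a + h) * (u b + h).
  by apply: ler_pM => //; [exact: le_trans a1|exact: le_trans b1].
have hh : h ^+ 2 <= h by rewrite expr2 ler_piMr// ltW.
have e5 : h ^+ 2 * wv h a b <= (u a + h) * (u b + h).
  apply: le_trans e4; rewrite (_ : h * m1 h a * _ = h ^+ 2 * (m1 h a * m1 h b)).
    by rewrite ler_wpM2l// sqr_ge0.
  by ring.
have e6 : 0 <= h ^+ 2 * m1 h a.
  by rewrite expr2 -mulrA mulr_ge0 ?(ltW h0)//; exact: le_trans a1.
have ua := u_ge0 a; have ub := u_ge0 b.
move: e1 e2 e5 e6 hh; rewrite !mulrDr !mulrDl !mulrN -!expr2.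
by nra.
Qed.

Let YY_lower (a b : R) : 0 <= a -> a <= b -> u a * u (b - a) + 2^-1 * YY a a <= YY a b.
Proof.
move=> a0 ab; have b0 := le_trans a0 ab.
apply: (@ler_limit_scale _ _ _ (2 * u a + u b + 2)).
  by rewrite !addr_ge0// mulr_ge0.
move=> h h0 h1.
have /andP[_ e1] := YY_bounds h0 ab; have /andP[e2 _] := YY_bounds h0 (lexx a).
have [_ /andP[e3 _]] := wvE a b h0.
have /andP[a1 a2] := m1_bounds a h0; have /andP[b1 b2] := m1_bounds (b - a) h0.
have e4 : u a * u (b - a) <= (h * m1 h a) * (h * m1 h (b - a)) by apply: ler_pM.
have hh : h ^+ 2 <= h by rewrite expr2 ler_piMr// ltW.
have e5 : u a * u (b - a) <= h ^+ 2 * wv h a b.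
  apply: le_trans e4 _; rewrite (_ : h * m1 h a * _ = h ^+ 2 * (m1 h a * m1 h (b - a))).
    by rewrite ler_wpM2l// sqr_ge0.
  by ring.
have e6 : h ^+ 2 * m1 h a <= h * (u a + h).
  by rewrite expr2 -mulrA (ler_wpM2l (ltW h0)).
have ua := u_ge0 a; have ub := u_ge0 b.
move: e1 e2 e5 e6 hh; rewrite !mulrDr !mulrN -!expr2.
by nra.
Qed.

Let u1_gt0 : 0 < u 1.
Proof.
pose h : R := 2^-1; have h0 : 0 < h by rewrite invr_gt0.
have h_ge0 := ltW h0.
have p_gt0 : 0 < p h 1.
  have [_ hE] := subordinator_cdf subD 1 h_ge0.
  have hL := subordinator_laplace subD lapD h_ge0 (@ltr01 R); rewrite powR1 mulr1 in hL.
  have : expR (- h) <= p h 1 + expR (- 1).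
    apply: (has_mean_le hL (has_meanD hE (has_mean_cst P (expR (- 1))))).
    apply: aeW => w /=; rewrite mul1r indicE.
    have [/set_mem /= Dw|/negP nDw] := boolP (w \in [set w | D h w <= 1]).
      apply: (@le_trans _ _ 1); last by rewrite lerDl expR_ge0.
      by rewrite -expR0 ler_expR oppr_le0; exact: (subordinator_ge0 subD _ h_ge0).
    rewrite add0r ler_expR lerN2 ltW// ltNge; apply/negP => Dw; apply: nDw.
    exact: mem_set.
  have : expR (- 1) < expR (- h) by rewrite ltr_expR ltrN2 invf_lt1// ltr1n.
  lra.
have ht := has_meanZ h (has_mean_tail 1 1%N h0); rewrite mul1r in ht.
have : h * p h 1 <= u 1.
  apply: (has_mean_le ht (has_mean_Y 1)); apply: aeW => w.
  have [Y0 _ Yh] := Y_bounds 1 w h0.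
  have [lt1|_] := ltnP 1 (tau h 1 w); last by rewrite mulr0.
  rewrite mulr1 -(lerD2r h); apply: le_trans Yh.
  rewrite (_ : h + h = 2%:R * h); last by ring.
  by rewrite (ler_wpM2r h_ge0)// ler_nat.
by apply: lt_le_trans; rewrite mulr_gt0.
Qed.

(** Otherwise Y 1 would be almost surely constant and uncorrelated with every
    Y b, whereas by YY_lower the covariance of Y 1 and Y b tends to half of the
    second moment of Y 1: the power function being concave, b `^ alpha and
    (b - 1) `^ alpha get close. *)
Let u1_lt_YY11 : u 1 ^+ 2 < YY 1 1.
Proof.
have uV : u 1 ^+ 2 <= YY 1 1.
  have := has_meanB (has_meanD (has_mean_YY 1 1) (has_mean_cst P (u 1 ^+ 2)))
    (has_meanZ (2 * u 1) (has_mean_Y 1)).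
  move=> /has_mean_ge0_le; rewrite expr2 => h; suff : 0 <= YY 1 1 + u 1 * u 1 - 2 * u 1 * u 1.
    by lra.
  apply: h; apply: aeW => w; have := sqr_ge0 (Y 1 w - u 1); rewrite expr2; nra.
have u2 : 0 < u 1 ^+ 2 by rewrite exprn_gt0// u1_gt0.
rewrite ltNge; apply/negP => le_YY.
have [al0 al1] := andP halpha.
(* L is such that the power function grows by at most 1 / 4 between L and L + 1. *)
pose L : R := 4 `^ ((1 - alpha)^-1).
have L0 : 0 < L by rewrite powR_gt0.
have L_pow : L `^ (alpha - 1) = 4^-1.
  rewrite /L -powRrM (_ : (1 - alpha)^-1 * (alpha - 1) = - 1) ?powRN ?powRr1//.
  by field; rewrite gt_eqF// subr_gt0.
have inc := @powR_increment_le R 1 L alpha ler01 L0.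
rewrite al0 (ltW al1) mul1r L_pow in inc; have {inc} inc := inc isT.
pose b := L + 1; have b1 : 1 <= b by rewrite /b lerDr ltW.
have b0 : 0 <= b by lra.
have low := YY_lower ler01 b1; rewrite /b addrK (uE (ltW L0)) in low.
have bal0 : 0 < b `^ alpha by rewrite powR_gt0//; lra.
have up : YY 1 b <= b `^ alpha * YY 1 1.
  have := has_meanD (has_meanZ (b `^ alpha) (has_mean_YY 1 1))
    (has_meanZ ((b `^ alpha)^-1) (has_mean_YY b b)).
  rewrite (YYE b0) [2 * alpha]mulrC powRrM powR_mulrn ?powR_ge0//.
  set th := b `^ alpha in bal0 *.
  rewrite (_ : th^-1 * (YY 1 1 * th ^+ 2) = th * YY 1 1); last by field; rewrite gt_eqF.
  move=> hr; have := has_mean_le (has_meanZ 2 (has_mean_YY 1 b)) hr.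
  move=> h; suff : 2 * YY 1 b <= th * YY 1 1 + th * YY 1 1 by lra.
  apply: h; apply: aeW => w.
  have : 0 <= th^-1 * (th * Y 1 w - Y b w) ^+ 2.
    by rewrite mulr_ge0 ?sqr_ge0// invr_ge0 ltW.
  rewrite (_ : th^-1 * _ = th * (Y 1 w * Y 1 w) + th^-1 * (Y b w * Y b w) -
    2 * (Y 1 w * Y b w)); first by rewrite subr_ge0.
  by field; rewrite gt_eqF.
rewrite -/b in inc low.
move: low up inc uV le_YY u2 bal0.
set B := b `^ alpha; set La := L `^ alpha; set M := YY 1 1; set c := u 1.
rewrite !expr2; move=> *; nra.
Qed.

(** All that is needed about the inverse stable subordinator: self-similar first
    and second moments, and bounds on the mixed moment K x y which pin it down up
    to a term that vanishes as y tends to infinity.  The constants are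
    c = 1 / Gamma (1 + alpha) and c2 = 2 / Gamma (1 + 2 alpha); that
    c ^+ 2 < c2 says that Y x has a positive variance for x > 0. *)
Lemma inverse_stable_moments : exists (c c2 : R) (K : R -> R -> R),
  [/\ 0 < c /\ c ^+ 2 < c2,
      (forall x, 0 <= x -> has_mean P (Y x) (c * x `^ alpha)),
      (forall x y, has_mean P (fun w => Y x w * Y y w) (K x y)),
      (forall x, 0 <= x -> K x x = c2 * x `^ (2 * alpha)) &
      (forall x y, 0 <= x -> x <= y ->
         c ^+ 2 * (x `^ alpha * (y - x) `^ alpha) + 2^-1 * c2 * x `^ (2 * alpha) <=
         K x y <=
         c ^+ 2 * (x `^ alpha * y `^ alpha) + 2^-1 * c2 * x `^ (2 * alpha))].
Proof.
exists (u 1), (YY 1 1), YY; split.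
- by split; [exact: u1_gt0|exact: u1_lt_YY11].
- by move=> x x0; rewrite -uE//; exact: has_mean_Y.
- exact: has_mean_YY.
- exact: YYE.
- move=> x y x0 xy; have := YY_lower x0 xy; have := YY_upper x0 xy.
  rewrite (uE x0) (uE (le_trans x0 xy)) (YYE x0) (uE (_ : 0 <= y - x)) ?subr_ge0//.
  move=> up low; apply/andP; split.
    by apply: le_trans low; rewrite le_eqVlt; apply/orP; left; apply/eqP; ring.
  by apply: le_trans up _; rewrite le_eqVlt; apply/orP; left; apply/eqP; ring.
Qed.

End inverse_stable.

(** * The fractional Skellam process of order k *)

Section right_continuity.
Context (R : realType).

(** The inner function may return to its limit, so the composition of right
    limits needs the value of g at y t as well. *)
Lemma cvg_right_comp (g y : R -> R) (t : R) :
  g v @[v --> (y t)^'+] --> g (y t) ->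
  (forall e, 0 < e -> \forall s \near t^'+, y t <= y s < y t + e) ->
  g (y s) @[s --> t^'+] --> g (y t).
Proof.
move=> hg hy; apply/cvgrPdist_lt => e e0.
move/cvgrPdist_lt : hg => /(_ e e0); rewrite near_withinE.
move=> /nbhs_ballP[r r0 hr]; apply: filterS (hy r r0) => s /andP[].
rewrite le_eqVlt => /orP[/eqP <- _|ys sr]; first by rewrite subrr normr0.
by apply: hr => //=; rewrite /ball /= distrC gtr0_norm ?subr_gt0// ltrBlDl.
Qed.

(** Where the path of D stays at or below t, the first passage time is the
    infimum of the empty set at t and at all later levels, hence constant. *)
Lemma first_passage_right_continuous d (T : measurableType d) (D : R -> T -> R)
    (t : R) (w : T) e :
  0 < e ->
  \forall s \near t^'+, first_passage D t w <= first_passage D s w < first_passage D t w + e.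
Proof.
move=> e0; rewrite /first_passage.
have lb s : has_lbound [set r | 0 <= r /\ s < D r w] by exists 0 => r [].
have [[r0 [r0_ge0 tr0]]|none] := pselect (exists r, 0 <= r /\ t < D r w); last first.
  have empty s : t <= s -> [set r | 0 <= r /\ s < D r w] = set0.
    move=> ts; apply/seteqP; split=> // r [r_ge0 sr]; apply: none.
    by exists r; split=> //; exact: le_lt_trans sr.
  near=> s; have ts : t <= s by near: s; exact: nbhs_right_ge.
  by rewrite !empty// inf0 lexx add0r.
have At : has_inf [set r | 0 <= r /\ t < D r w] by split => //; exists r0.
have [r [r_ge0 tr] r_lt] := inf_adherent e0 At.
near=> s; have ts : t <= s by near: s; exact: nbhs_right_ge.
have sr : s < D r w by near: s; exact: nbhs_right_lt.
apply/andP; split.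
  apply: lb_le_inf; first by exists r.
  move=> q [q0 sq]; apply: ge_inf => //; split=> //; exact: le_lt_trans sq.
by apply: le_lt_trans r_lt; apply: ge_inf.
Unshelve. all: end_near. Qed.

End right_continuity.

Section fractional_skellam.
Context d (T : measurableType d) (R : realType) (P : probability T R).
Variables (k : nat) (lambda1 lambda2 alpha : R) (S : R -> T -> R).
Hypotheses (k0 : (0 < k)%N) (lambda1_gt0 : 0 < lambda1) (lambda2_gt0 : 0 < lambda2).
Hypotheses (halpha : 0 < alpha < 1) (hS : FSPoK P k lambda1 lambda2 alpha S).

Lemma FSPoK_measurable_right_continuous :
  (forall t : R, 0 <= t -> measurable_fun setT (S t)) /\
  (forall (t : R) w, 0 <= t -> S s w @[s --> t^'+] --> S t w).
Proof.
have [Sk [D [hSk hD YS SE]]] := hS.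
have [m [v [v0 mSk rcSk hm hK]]] := SPoK_moments k0 lambda1_gt0 lambda2_gt0 hSk.
have subD : subordinator P D by case: hD.
have mY (t : R) : nonneg_times t -> measurable_fun setT (first_passage D t).
  by move=> _; exact: (measurable_first_passage subD).
split=> [t t0|t w t0].
  have -> : S t = (fun w => Sk (first_passage D t w) w) by apply/funext => w; exact: SE.
  apply: (measurable_subordinated mY mSk rcSk); last first.
    by move=> w; exact: (first_passage_ge0 subD).
  exact: (measurable_family (D := @nonneg_times R)).
rewrite SE//; apply: cvg_trans (_ : _ --> _); last first.
  apply: (@cvg_right_comp R (Sk ^~ w) (fun s => first_passage D s w) t).
    by apply: rcSk; exact: (first_passage_ge0 subD).
  by move=> e e0; exact: first_passage_right_continuous.
apply: near_eq_cvg; near=> s; rewrite SE//.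
by rewrite (le_trans t0)//; near: s; exact: nbhs_right_ge.
Unshelve. all: end_near. Qed.

(** Evaluating the Skellam process at the inverse stable subordinator Y turns its
    covariance kernel v min(s, t) + m^2 s t into
    v E (min (Y_x, Y_y)) + m^2 E (Y_x Y_y). *)
Lemma FSPoK_moments : exists (m v c c2 : R) (K : R -> R -> R),
  [/\ [/\ 0 < v, 0 < c & c ^+ 2 < c2],
      (forall x, 0 <= x -> has_mean P (S x) (m * (c * x `^ alpha))),
      (forall x y, 0 <= x -> 0 <= y -> has_mean P (fun w => S x w * S y w) (K x y)),
      (forall x, 0 <= x ->
         K x x = v * (c * x `^ alpha) + m ^+ 2 * (c2 * x `^ (2 * alpha))) &
      (forall x y, 0 <= x -> x <= y ->
         v * (c * x `^ alpha) + m ^+ 2 *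
           (c ^+ 2 * (x `^ alpha * (y - x) `^ alpha) + 2^-1 * c2 * x `^ (2 * alpha)) <=
         K x y <=
         v * (c * x `^ alpha) + m ^+ 2 *
           (c ^+ 2 * (x `^ alpha * y `^ alpha) + 2^-1 * c2 * x `^ (2 * alpha)))].
Proof.
have [Sk [D [hSk hD YS SE]]] := hS.
have [m [v [v0 mSk rcSk hm hK]]] := SPoK_moments k0 lambda1_gt0 lambda2_gt0 hSk.
have [c [c2 [K [[c0 cc2] hY hYY Kdiag Kbounds]]]] := inverse_stable_moments halpha hD.
have subD : subordinator P D by case: hD.
have mY (t : R) : nonneg_times t -> measurable_fun setT (first_passage D t).
  by move=> _; exact: (measurable_first_passage subD).
have fY (t : R) : 0 <= t ->
    measurable_fun [set: family_space (@nonneg_times R) (first_passage D)]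
      (first_passage D t).
  by move=> t0; exact: (measurable_family (D := @nonneg_times R)).
have Y0 t w : 0 <= first_passage D t w by exact: (first_passage_ge0 subD).
have hmin x y : 0 <= x -> x <= y ->
    has_mean P (fun w => Num.min (first_passage D x w) (first_passage D y w))
      (c * x `^ alpha).
  move=> x0 xy; apply: has_mean_ae (hY x x0).
    exact: (@measurable_minr _ _ _ setT (first_passage D x) (first_passage D y)
       (mY x x0) (mY y (le_trans x0 xy))).
  by apply: filterS (first_passage_ae_le hD xy) => w le; rewrite min_l.
pose KS x y := v * (c * (Num.min x y) `^ alpha) + m ^+ 2 * K x y.
have hKY x y : 0 <= x -> 0 <= y ->
    has_mean P (fun w => v * Num.min (first_passage D x w) (first_passage D y w) +
      m ^+ 2 * (first_passage D x w * first_passage D y w)) (KS x y).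
  move=> x0 y0; apply: has_meanD; last exact/has_meanZ/hYY.
  apply: has_meanZ; have [xy|yx] := leP x y; first exact: hmin.
  by apply: has_mean_ext (hmin _ _ y0 (ltW yx)) => w; rewrite minC.
have SE' x : 0 <= x -> (fun w => Sk (first_passage D x w) w) = S x.
  by move=> x0; apply/funext => w; rewrite SE.
exists m, v, c, c2, KS; split.
- by split.
- move=> x x0.
  have hm2 s : 0 <= s -> has_mean P (fun w => Sk s w ^+ 2) (v * s + m ^+ 2 * (s * s)).
    move=> s0; have := hK _ _ s0 s0; rewrite minxx.
    by apply: has_mean_ext => w; rewrite expr2.
  have h2 : has_mean P (fun w => v * first_passage D x w +
      m ^+ 2 * (first_passage D x w * first_passage D x w)) (KS x x).
    by apply: has_mean_ext (hKY _ _ x0 x0) => w; rewrite minxx.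
  have [e [he1 he2]] := has_mean_subordinated mY mSk rcSk YS (fY x x0) (Y0 x) hm hm2 h2.
  rewrite -SE'// (has_mean_unique (has_meanZ m (hY x x0)) he1).
  exact: he2.
- move=> x y x0 y0.
  have hAA := hKY _ _ x0 x0; have hBB := hKY _ _ y0 y0.
  have [e [he1 he2]] := has_mean_subordinated_product mY mSk rcSk YS (fY x x0) (fY y y0)
    (Y0 x) (Y0 y) hK hAA hBB.
  rewrite (has_mean_unique (hKY _ _ x0 y0) he1).
  by apply: has_mean_ext he2 => w; rewrite !SE.
- by move=> x x0; rewrite /KS minxx Kdiag.
- move=> x y x0 xy; rewrite /KS min_l// !lerD2l.
  have /andP[lo up] := Kbounds x y x0 xy.
  by rewrite !ler_wpM2l ?sqr_ge0.
Qed.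

End fractional_skellam.

(** * Covariances and limits at infinity *)

Section covariances.
Context d (T : measurableType d) (R : realType) (P : probability T R).

Lemma has_mean_Lfun2 (X : T -> R) a : measurable_fun setT X ->
  has_mean P (fun w => X w * X w) a -> X \in Lfun P 2%:E.
Proof.
move=> mX [iX EX]; rewrite inE; apply/andP; split; rewrite inE//=.
rewrite /finite_norm unlock; apply: poweR_lty.
rewrite (_ : (\int[P]_x _ = a%:E)%E) ?ltry// -EX.
apply: eq_integral => w _.
by rewrite /= powR_mulrn ?normr_ge0// real_normK ?num_real// expr2.
Qed.

Lemma has_mean_covariance (X Y : T -> R) a b c :
  has_mean P X a -> has_mean P Y b -> has_mean P (fun w => X w * Y w) c ->
  fine (covariance P X Y) = c - a * b.
Proof.
move=> hX hY hXY.
have LX : X \in Lfun P 1 by apply/Lfun1_integrable; case: hX.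
have LY : Y \in Lfun P 1 by apply/Lfun1_integrable; case: hY.
have LXY : (X * Y)%R \in Lfun P 1 by apply/Lfun1_integrable; case: hXY.
rewrite covarianceE// (has_mean_expectation hX) (has_mean_expectation hY).
by rewrite (has_mean_expectation hXY).
Qed.

End covariances.

Section limits.
Context (R : realType).
Implicit Types (t s a b kappa : R).

Lemma cvg_powRN rho : 0 < rho -> t `^ (- rho) @[t --> +oo] --> (0 : R).
Proof.
move=> rho0; apply/cvgrPdist_le => e e0; near=> t.
have t0 : 0 < t by near: t; exact: nbhs_pinfty_gt.
rewrite sub0r normrN ger0_norm ?powR_ge0// powRN.
rewrite -[leRHS]invrK lef_pV2 ?posrE ?powR_gt0 ?invr_gt0//.
have te : (e^-1) `^ (rho^-1) <= t by near: t; apply: nbhs_pinfty_ge; exact: num_real.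
have := @ge0_ler_powR R rho (ltW rho0) _ _ _ _ te.
rewrite -powRrM mulVf ?gt_eqF// powRr1 ?invr_ge0 ?(ltW e0)//.
by apply; rewrite nnegrE ?powR_ge0// ltW.
Unshelve. all: end_near. Qed.

Lemma asymp_equiv_div (g : R -> R) (k rho : R) : 0 < k ->
  asymp_equiv g (fun t => k * t `^ rho) -> g t / t `^ rho @[t --> +oo] --> k.
Proof.
move=> k0 h; rewrite -[X in _ --> X]mulr1.
apply: cvg_trans (_ : _ --> _); last exact: cvgM (cvg_cst k) h.
apply: near_eq_cvg; near=> t; rewrite /= invfM.
by field; rewrite (gt_eqF k0) gt_eqF//= powR_gt0//; near: t; exact: nbhs_pinfty_gt.
Unshelve. all: end_near. Qed.

Lemma LRD_ratio_cvg (C V : R -> R) (sigma c kappa gamma : R) :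
  0 < kappa -> 0 < sigma ->
  C t @[t --> +oo] --> c -> V t / t `^ (2 * gamma) @[t --> +oo] --> kappa ->
  C t / (sigma * Num.sqrt (V t) * t `^ (- gamma)) @[t --> +oo]
    --> c / (sigma * Num.sqrt kappa).
Proof.
move=> kappa0 sigma0 hC hV.
have hsqrt : Num.sqrt (V t / t `^ (2 * gamma)) @[t --> +oo] --> Num.sqrt kappa.
  apply: (cvg_comp _ _ hV); exact: sqrt_continuous.
apply: cvgM => //; apply: cvg_trans (_ : _ --> _); last first.
  have den0 : sigma * Num.sqrt kappa != 0.
    by apply: lt0r_neq0; rewrite mulr_gt0// sqrtr_gt0.
  exact: (cvgV den0 (cvgM (cvg_cst sigma) hsqrt)).
apply: near_eq_cvg; near=> t; congr (_^-1); rewrite -mulrA; congr (_ * _).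
have t0 : 0 < t by near: t; exact: nbhs_pinfty_gt.
rewrite [2 * gamma]mulrC powRrM powR_mulrn ?powR_ge0//.
rewrite [_ / _]mulrC sqrtrM ?invr_ge0 ?sqr_ge0// -exprVn sqrtr_sqr powRN mulrC.
by rewrite ger0_norm// invr_ge0 powR_ge0.
Unshelve. all: end_near. Qed.

(** The level L is chosen first, to make the second term small; the first term
    then vanishes as t grows. *)
Lemma exp_decay_cvg (C : R -> R) (c A B s alpha : R) (g : R -> R) :
  0 <= A -> 0 <= B -> alpha < 1 -> (forall x, 0 < x -> 0 < g x) ->
  (forall L t, 0 < L -> s <= t ->
     `|C t - c| <= A * expR (- ((t - s) * g L)) + B * L `^ (alpha - 1)) ->
  C t @[t --> +oo] --> c.
Proof.
move=> A0 B0 al1 g0 H; apply/cvgrPdist_le => e e0.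
pose de := e / (2 * (B + 1)).
have de0 : 0 < de by rewrite divr_gt0// mulr_gt0// ltr_wpDl.
pose L := de `^ (alpha - 1)^-1.
have L0 : 0 < L by rewrite powR_gt0.
have LE : L `^ (alpha - 1) = de.
  by rewrite /L -powRrM mulVf ?powRr1 ?(ltW de0)// lt_eqF// subr_lt0.
have gL := g0 L L0.
near=> t; have st : s <= t by near: t; apply: nbhs_pinfty_ge; exact: num_real.
rewrite distrC; apply: le_trans (H L t L0 st) _; rewrite LE [leRHS]splitr.
apply: lerD; last first.
  have -> : e / 2 = (B + 1) * de by rewrite /de; field; rewrite gt_eqF// ltr_wpDl.
  by rewrite mulrDl mul1r lerDl ltW.
have y0 : 0 < 1 + (t - s) * g L by rewrite ltr_pwDl// mulr_ge0 ?subr_ge0// ltW.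
rewrite expRN ler_pdivrMr ?expR_gt0//.
have te : s + 2 * A / (e * g L) <= t by near: t; apply: nbhs_pinfty_ge; exact: num_real.
have h : A <= e / 2 * ((t - s) * g L).
  have : 2 * A <= (t - s) * (e * g L) by rewrite -ler_pdivrMr ?mulr_gt0//; lra.
  lra.
apply: (le_trans h); rewrite ler_wpM2l//; first by rewrite divr_ge0// ltW.
by apply: le_trans (expR_ge1Dx _); rewrite lerDr.
Unshelve. all: end_near. Qed.

End limits.

(** * Power moments of a subordinator *)

Section power_moments.
Context d (T : measurableType d) (R : realType) (P : probability T R).
Variables (f : R -> R) (D : R -> T -> R).
Hypotheses (subD : subordinator P D) (lapD : laplace_exponent P D f).
Hypothesis hmoments : forall r t : R, 0 < r -> 0 <= t ->
  ('E_P[fun w => (D t w `^ r)%R] < +oo)%E.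

Definition power_moment (r t : R) : R := fine 'E_P[fun w => (D t w `^ r)%R]%E.
Local Notation E := power_moment.

Lemma has_mean_power r t : 0 <= r -> 0 <= t ->
  has_mean P (fun w => D t w `^ r) (E r t).
Proof.
rewrite le_eqVlt => /orP[/eqP <- _|r0 t0].
  rewrite /E unlock; under eq_integral do rewrite powRr0.
  under eq_fun do rewrite powRr0.
  by have [_ ->] := has_mean_cst P 1; exact: has_mean_cst.
have := hmoments r0 t0; rewrite /E unlock => h.
apply: has_mean_finite => //; last by move=> w; exact: powR_ge0.
by apply: (measurableT_comp (measurable_powR r)); exact: (subordinator_measurable subD).
Qed.

Lemma power_moment_ge0 r t : 0 <= r -> 0 <= t -> 0 <= E r t.
Proof.
move=> r0 t0; apply: has_mean_ge0_le (has_mean_power r0 t0) _.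
by apply: aeW => w; exact: powR_ge0.
Qed.

Lemma power_moment_le r s t : 0 < r -> 0 <= s -> s <= t -> E r s <= E r t.
Proof.
move=> r0 s0 st; have t0 := le_trans s0 st.
apply: (has_mean_le (has_mean_power (ltW r0) s0) (has_mean_power (ltW r0) t0)).
apply: aeW => w; apply: ge0_ler_powR; rewrite ?nnegrE ?(ltW r0)//.
- exact: (subordinator_ge0 subD).
- exact: (subordinator_ge0 subD).
- exact: (subordinator_le subD).
Qed.

Lemma power_moment_sqr_le (a t : R) : 0 < a -> 0 <= t -> E a t ^+ 2 <= E (2 * a) t.
Proof.
move=> a0 t0; have a20 : 0 < 2 * a by rewrite mulr_gt0.
have hvar := has_meanB (has_meanD (has_mean_power (ltW a20) t0) (has_mean_cst P (E a t ^+ 2)))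
  (has_meanZ (2 * E a t) (has_mean_power (ltW a0) t0)).
have /(has_mean_ge0_le hvar) : {ae P, forall w, 0 <= D t w `^ (2 * a) + E a t ^+ 2 -
    2 * E a t * D t w `^ a}.
  apply: aeW => w; rewrite [2 * a]mulrC powRrM powR_mulrn ?powR_ge0//.
  have := sqr_ge0 (D t w `^ a - E a t); rewrite !expr2; nra.
rewrite !expr2; lra.
Qed.

(** If f u <= 0 then expR (- (u * D_t)), which is at most 1, has mean at least 1,
    so that D_t = 0 almost surely. *)
Lemma laplace_exponent_gt0 (r t u : R) : 0 < r -> 0 <= t -> 0 < u ->
  0 < E r t -> 0 < f u.
Proof.
move=> r0 t0 u0 Ert; rewrite ltNge; apply/negP => fu.
have hL := subordinator_laplace subD lapD t0 u0.
have hge := has_meanB (has_mean_cst P 1) hL.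
have X0 w : 0 <= 1 - expR (- (u * D t w)).
  by rewrite subr_ge0 -expR0 ler_expR oppr_le0 mulr_ge0 ?(ltW u0)// (subordinator_ge0 subD).
have E0 : 1 - expR (- (t * f u)) = 0.
  apply/eqP; rewrite eq_le; apply/andP; split.
    by rewrite subr_le0 -expR0 ler_expR oppr_ge0 mulr_ge0_le0.
  by apply: has_mean_ge0_le hge _; apply: aeW.
rewrite E0 in hge.
have D0 : {ae P, forall w, D t w = 0}.
  apply: filterS (has_mean0_ae X0 hge) => w /eqP; rewrite subr_eq0 => /eqP.
  rewrite -{1}expR0 => /expR_inj /eqP.
  by rewrite eq_sym oppr_eq0 mulf_eq0 (gt_eqF u0) => /eqP.
suff : E r t <= 0 by rewrite leNgt Ert.
apply: (has_mean_le (has_mean_power (ltW r0) t0) (has_mean_cst P 0)).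
by apply: filterS D0 => w ->; rewrite powR0// gt_eqF.
Qed.

(** From 1 - expR (- x) <= x `^ a for x >= 0. *)
Lemma power_moment_gt0 (a t : R) : 0 < a < 1 -> 0 < t -> 0 < f 1 -> 0 < E a t.
Proof.
move=> /andP[a0 a1] t0 f1; have t_ge0 := ltW t0.
have hL := has_meanB (has_mean_cst P 1) (subordinator_laplace subD lapD t_ge0 (@ltr01 R)).
have le : 1 - expR (- (t * f 1)) <= E a t.
  apply: (has_mean_le hL (has_mean_power (ltW a0) t_ge0)); apply: aeW => w; rewrite mul1r.
  have D0 := subordinator_ge0 subD w t_ge0.
  have [D1|D1] := leP (D t w) 1; last first.
    apply: (@le_trans _ _ (1 `^ a)); first by rewrite powR1 gerBl expR_ge0.
    by rewrite ge0_ler_powR ?nnegrE// ltW.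
  apply: (@le_trans _ _ (D t w)).
    by rewrite lerBlDr -lerBlDl; apply: le_trans (expR_ge1Dx _); lra.
  move: D0; rewrite le_eqVlt => /orP[/eqP <-|D0]; first exact: powR_ge0.
  by apply: ger1_powR; [rewrite D0 D1|exact: ltW].
by apply: lt_le_trans le; rewrite subr_gt0 -[ltRHS]expR0 ltr_expR oppr_lt0 mulr_gt0.
Qed.

Variables (alpha : R).
Hypothesis halpha : 0 < alpha < 1.

Let alpha0 : 0 < alpha. Proof. by case/andP: halpha. Qed.
Let halpha' : 0 < alpha <= 1. Proof. by case/andP: halpha => -> /ltW ->. Qed.

Let measurable_increment (s t : R) : 0 <= s -> s <= t ->
  measurable_fun setT (fun w => D t w - D s w).
Proof.
move=> s0 st; have t0 := le_trans s0 st.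
by apply: measurable_funB; exact: (subordinator_measurable subD).
Qed.

Lemma has_mean_increment_function (s t p e : R) (psi : R -> R) :
  0 <= s -> s <= t -> 0 <= p -> measurable_fun setT psi -> (forall x, 0 <= psi x) ->
  has_mean P (fun w => psi (D (t - s) w)) e ->
  has_mean P (fun w => D s w `^ p * psi (D t w - D s w)) (E p s * e).
Proof.
move=> s0 st p0 mpsi psi0 he; have ts0 : 0 <= t - s by rewrite subr_ge0.
have mI := measurable_increment s0 st.
have law (B : set R) : measurable B ->
    P ((fun w => D t w - D s w) @^-1` B) = P (D (t - s) @^-1` B).
  by case: subD => -[_ _ _ stat _] _ _ mB; exact: stat.
have hinc : has_mean P (fun w => psi (D t w - D s w)) e.
  apply: has_mean_ge0 => //; first exact: measurableT_comp.
  have [_ <-] := he.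
  pose X : {RV P >-> R} := HB.pack (fun w => D t w - D s w)
    (isMeasurableFun.Build _ _ _ _ _ mI).
  pose X' : {RV P >-> R} := HB.pack (D (t - s))
    (isMeasurableFun.Build _ _ _ _ _ (subordinator_measurable subD ts0)).
  have mE : measurable_fun setT (EFin \o psi) by exact/measurable_EFinP.
  rewrite -(@ge0_integral_distribution _ _ _ _ _ P X (EFin \o psi))//.
  rewrite -(@ge0_integral_distribution _ _ _ _ _ P X' (EFin \o psi))//.
  by apply: eq_measure_integral => A mA _; exact: law.
apply: has_meanM_independent => //.
- move=> A B mA mB.
  have mpA : measurable ((fun x : R => x `^ p) @^-1` A).
    by rewrite -[X in measurable X]setTI; exact: measurable_powR.
  have mpB : measurable (psi @^-1` B).
    by rewrite -[X in measurable X]setTI; exact: mpsi.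
  have := subordinator_increment_independent subD s0 st mpA mpB.
  by rewrite -law.
- by move=> w; exact: powR_ge0.
- exact: has_mean_power.
Qed.

(** Replacing D_t by the increment D_t - D_s, which is independent of D_s,
    changes the mixed moment of the powers by the mean of an increment of a concave
    power function.  This change vanishes as t tends to infinity: the
    first error term does for every fixed L, and the second one is small when L is
    large. *)
Lemma power_product_bounds (s t p L : R) : 0 <= s -> s <= t -> 0 <= p -> 0 < L ->
  exists2 g, has_mean P (fun w => D s w `^ p * D t w `^ alpha) g &
    E p s * E alpha (t - s) <= g <= E p s * E alpha (t - s) +
      (E (p + alpha) s * (expR 1 * expR (- ((t - s) * f L^-1))) +
       E (p + 1) s * L `^ (alpha - 1)).
Proof.
move=> s0 st p0 L0; have t0 := le_trans s0 st; have ts0 : 0 <= t - s by rewrite subr_ge0.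
have al_ge0 := ltW alpha0; have LV0 : 0 < L^-1 by rewrite invr_gt0.
have pal0 : 0 <= p + alpha by rewrite addr_ge0.
have D_ge0 w (r : R) : 0 <= r -> 0 <= D r w by exact: (subordinator_ge0 subD).
have Dst w : D s w <= D t w by exact: (subordinator_le subD).
have powD x q : 0 <= x -> 0 < q -> x `^ (p + q) = x `^ p * x `^ q.
  by move=> x0 q0; rewrite powRD// gt_eqF// ltr_wpDl.
have mpow r (r0 : 0 <= r) q : measurable_fun setT (fun w => D r w `^ q).
  by apply: (measurableT_comp (measurable_powR q)); exact: (subordinator_measurable subD).
have [g hg] : exists g, has_mean P (fun w => D s w `^ p * D t w `^ alpha) g.
  apply: (has_mean_dominated _ (has_mean_power pal0 t0)).
    by apply: measurable_funM; exact: mpow.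
  apply: aeW => w; rewrite ger0_norm ?mulr_ge0 ?powR_ge0// powD// ?D_ge0//.
  rewrite ler_wpM2r ?powR_ge0//; apply: ge0_ler_powR => //; rewrite nnegrE D_ge0//.
have hpow := has_mean_increment_function s0 st p0 (measurable_powR alpha)
  (fun=> powR_ge0 _ _) (has_mean_power al_ge0 ts0).
have mexp : measurable_fun setT (fun y : R => expR (- (L^-1 * y))).
  by apply: measurableT_comp => //; apply: measurableT_comp => //; exact: measurable_funM.
have hexp := has_mean_increment_function s0 st pal0 mexp (fun=> expR_ge0 _)
  (subordinator_laplace subD lapD ts0 LV0).
have p10 : 0 <= p + 1 by rewrite addr_ge0.
have hlast := has_meanZ (L `^ (alpha - 1)) (has_mean_power p10 s0).
exists g => //; apply/andP; split.
  apply: (has_mean_le hpow hg); apply: aeW => w; rewrite ler_wpM2l ?powR_ge0//.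
  apply: ge0_ler_powR; rewrite ?nnegrE ?subr_ge0 ?D_ge0//.
  by rewrite gerBl D_ge0.
have hup := has_meanD hpow (has_meanD (has_meanZ (expR 1) hexp) hlast).
rewrite (_ : _ + (_ + _) = E p s * E alpha (t - s) +
      (E (p + alpha) s * (expR 1 * expR (- ((t - s) * f L^-1))) +
       E (p + 1) s * L `^ (alpha - 1))) in hup; last by ring.
apply: (has_mean_le hg hup); apply: aeW => w.
rewrite !powD ?D_ge0// powRr1 ?D_ge0//.
have x0 : 0 <= D t w - D s w by rewrite subr_ge0.
have := powR_increment_exp_le (D_ge0 w s s0) x0 L0 halpha'.
rewrite subrK; set A := D s w `^ alpha; set B := D t w `^ alpha.
set C := (D t w - D s w) `^ alpha; set ex := expR 1; set ey := expR _.
set q := D s w `^ p; set l := L `^ _ => h.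
rewrite (_ : q * C + _ = q * (C + (A * (ex * ey) + D s w * l))); last by ring.
by rewrite ler_wpM2l ?powR_ge0// -lerBlDl.
Qed.

End power_moments.

(** * Covariances of the time-changed process and long-range dependence *)

Section subordinated_fractional_skellam.
Context d (T : measurableType d) (R : realType) (P : probability T R).
Variables (k : nat) (lambda1 lambda2 alpha : R) (S : R -> T -> R).
Hypotheses (k0 : (0 < k)%N) (lambda1_gt0 : 0 < lambda1) (lambda2_gt0 : 0 < lambda2).
Hypotheses (halpha : 0 < alpha < 1) (hS : FSPoK P k lambda1 lambda2 alpha S).
Variables (f : R -> R) (D : R -> T -> R).
Hypotheses (subD : subordinator P D) (lapD : laplace_exponent P D f).
Hypothesis hmoments : forall r t : R, 0 < r -> 0 <= t ->
  ('E_P[fun w => (D t w `^ r)%R] < +oo)%E.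
Hypothesis hindep : independent_families P (@nonneg_times R) S (@nonneg_times R) D.
Local Notation E := (power_moment P D).
Local Notation Z := (fun t w => S (D t w) w).

Let alpha0 : 0 < alpha. Proof. by case/andP: halpha. Qed.
Let alpha20 : 0 < 2 * alpha. Proof. by rewrite mulr_gt0. Qed.

(** The bounds on the mixed moments of the inverse stable subordinator and of the
    powers of D combine into a rate at which the covariance approaches a positive
    limit that depends on s only. *)
Lemma subordinated_moments : exists m v c c2 : R,
  [/\ [/\ 0 < v, 0 < c & c ^+ 2 < c2],
      (forall t, 0 <= t -> Z t \in Lfun P 2%:E),
      (forall t, 0 <= t -> fine ('V_P[Z t])%E =
         v * c * E alpha t + m ^+ 2 * (c2 * E (2 * alpha) t - c ^+ 2 * E alpha t ^+ 2)) &
      (forall s t L, 0 <= s -> s <= t -> 0 < L ->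
         `|fine (covariance P (Z s) (Z t)) -
           (v * c * E alpha s + m ^+ 2 * (2^-1 * c2 * E (2 * alpha) s))| <=
         m ^+ 2 * c ^+ 2 * expR 1 * (E (2 * alpha) s + E alpha s ^+ 2) *
           expR (- ((t - s) * f L^-1)) +
         m ^+ 2 * c ^+ 2 * (E (alpha + 1) s + E alpha s * E 1 s) *
           L `^ (alpha - 1))].
Proof.
have [mS rcS] := FSPoK_measurable_right_continuous k0 lambda1_gt0 lambda2_gt0 hS.
have [m [v [c [c2 [K [[v0 c0 cc2] hm hK Kdiag Kbounds]]]]]] :=
  FSPoK_moments k0 lambda1_gt0 lambda2_gt0 halpha hS.
have mD (t : R) : nonneg_times t -> measurable_fun setT (D t).
  by move=> t0; exact: (subordinator_measurable subD t0).
have fD (t : R) : 0 <= t -> measurable_fun [set: family_space (@nonneg_times R) D] (D t).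
  by move=> t0; exact: (measurable_family (D := @nonneg_times R)).
have DS : independent_families P (@nonneg_times R) D (@nonneg_times R) S.
  by move=> A B hA hB; rewrite setIC muleC; exact: hindep.
have D_ge0 (t : R) : 0 <= t -> forall w, 0 <= D t w.
  by move=> t0 w; exact: (subordinator_ge0 subD).
have hE r t : 0 <= r -> 0 <= t -> has_mean P (fun w => D t w `^ r) (E r t).
  by move=> r0 t0; exact: (has_mean_power subD hmoments r0 t0).
have hdiag t : 0 <= t -> has_mean P (fun w => K (D t w) (D t w))
    (v * (c * E alpha t) + m ^+ 2 * (c2 * E (2 * alpha) t)).
  move=> t0; have hd := has_meanD
    (has_meanZ v (has_meanZ c (hE _ _ (ltW alpha0) t0)))
    (has_meanZ (m ^+ 2) (has_meanZ c2 (hE _ _ (ltW alpha20) t0))).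
  by apply: has_mean_ext hd => w; rewrite Kdiag// D_ge0.
have hZ t : 0 <= t -> has_mean P (Z t) (m * (c * E alpha t)).
  move=> t0.
  have hS2 x : 0 <= x -> has_mean P (fun w => S x w ^+ 2) (K x x).
    by move=> x0; apply: has_mean_ext (hK _ _ x0 x0) => w; rewrite expr2.
  have [e [he1 he2]] := has_mean_subordinated mD mS rcS DS (fD t t0) (D_ge0 t t0) hm hS2
    (hdiag t t0).
  rewrite -(has_mean_unique he1 (has_meanZ m (has_meanZ c (hE _ _ (ltW alpha0) t0)))).
  exact: he2.
have hZZ s t : 0 <= s -> 0 <= t -> exists2 e, has_mean P (fun w => K (D s w) (D t w)) e &
    has_mean P (fun w => Z s w * Z t w) e.
  move=> s0 t0.
  have [e [he1 he2]] := has_mean_subordinated_product mD mS rcS DS (fD s s0) (fD t t0)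
    (D_ge0 s s0) (D_ge0 t t0) hK (hdiag s s0) (hdiag t t0).
  by exists e.
have hZ2 t : 0 <= t -> has_mean P (fun w => Z t w * Z t w)
    (v * (c * E alpha t) + m ^+ 2 * (c2 * E (2 * alpha) t)).
  move=> t0; have [e he1 he2] := hZZ t t t0 t0.
  by rewrite -(has_mean_unique he1 (hdiag t t0)).
exists m, v, c, c2; split=> //.
- move=> t t0; apply: has_mean_Lfun2 (hZ2 t t0).
  exact: has_mean_measurable (hZ t t0).
- move=> t t0; rewrite /variance (has_mean_covariance (hZ t t0) (hZ t t0) (hZ2 t t0)).
  ring.
move=> s t L s0 st L0; have t0 := le_trans s0 st; have ts0 : 0 <= t - s by rewrite subr_ge0.
have [e he1 he2] := hZZ s t s0 t0.
rewrite (has_mean_covariance (hZ s s0) (hZ t t0) he2).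
have [g hg] := power_product_bounds subD lapD hmoments halpha s0 st (ltW alpha0) L0.
have [g' hg'] := power_product_bounds subD lapD hmoments halpha s0 st (lexx 0) L0.
have E0 : E 0 s = 1.
  have h0 := hE 0 s (lexx 0) s0; apply: (has_mean_unique h0).
  by apply: has_mean_ext (has_mean_cst P 1) => w; rewrite powRr0.
have -> : g' = E alpha t.
  apply: has_mean_unique hg' _.
  by apply: has_mean_ext (hE _ _ (ltW alpha0) t0) => w; rewrite powRr0 mul1r.
rewrite E0 mul1r !add0r -mulr2n -[alpha *+ 2]mulr_natl => /andP[_ Et_le].
move=> /andP[_ g_le].
have Ets_le : E alpha (t - s) <= E alpha t.
  by apply: (power_moment_le subD hmoments alpha0 ts0); lra.
have Es0 : 0 <= E alpha s by exact: (power_moment_ge0 subD hmoments (ltW alpha0) s0).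
have hpair : has_mean P (fun w => D s w `^ alpha * (D t w - D s w) `^ alpha)
    (E alpha s * E alpha (t - s)).
  exact: (has_mean_increment_function subD hmoments s0 st (ltW alpha0)
    (measurable_powR alpha) (fun=> powR_ge0 _ _) (hE _ _ (ltW alpha0) ts0)).
have hlo := has_meanD (has_meanZ v (has_meanZ c (hE _ _ (ltW alpha0) s0)))
  (has_meanZ (m ^+ 2) (has_meanD (has_meanZ (c ^+ 2) hpair)
    (has_meanZ (2^-1 * c2) (hE _ _ (ltW alpha20) s0)))).
have hup := has_meanD (has_meanZ v (has_meanZ c (hE _ _ (ltW alpha0) s0)))
  (has_meanZ (m ^+ 2) (has_meanD (has_meanZ (c ^+ 2) hg)
    (has_meanZ (2^-1 * c2) (hE _ _ (ltW alpha20) s0)))).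
have Dst w : D s w <= D t w by exact: (subordinator_le subD).
have lo := has_mean_le hlo he1
  (aeW _ (fun w => proj1 (andP (Kbounds _ _ (D_ge0 s s0 w) (Dst w))))).
have up := has_mean_le he1 hup
  (aeW _ (fun w => proj2 (andP (Kbounds _ _ (D_ge0 s s0 w) (Dst w))))).
move: lo up Et_le g_le.
set ex := expR (- _); set l := L `^ _; set a := E alpha s; set a2 := E (2 * alpha) s.
set b := E alpha t; set b' := E alpha (t - s); set a1 := E 1 s; set aa := E (alpha + 1) s.
set e1 := expR 1 => lo up Et_le g_le.
have mc0 : 0 <= m ^+ 2 * c ^+ 2 by rewrite mulr_ge0 ?sqr_ge0.
have ex0 : 0 <= e1 * ex by rewrite mulr_ge0 ?expR_ge0.
have l0 : 0 <= l by exact: powR_ge0.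
have a2_0 : 0 <= a2 by exact: (power_moment_ge0 subD hmoments (ltW alpha20) s0).
have a1_0 : 0 <= a1 by exact: (power_moment_ge0 subD hmoments ler01 s0).
have aa_0 : 0 <= aa.
  by apply: (power_moment_ge0 subD hmoments _ s0); rewrite addr_ge0// ltW.
rewrite ler_distl; apply/andP; split.
- apply: (@le_trans _ _ (v * (c * a) + m ^+ 2 * (c ^+ 2 * (a * b') + 2^-1 * c2 * a2) -
    m * (c * a) * (m * (c * b)))); last by rewrite lerD2r.
  have h1 : m ^+ 2 * c ^+ 2 * (a * b) <=
      m ^+ 2 * c ^+ 2 * (a * (b' + (a * (e1 * ex) + a1 * l))).
    by rewrite ler_wpM2l// ler_wpM2l.
  have h2 : 0 <= m ^+ 2 * c ^+ 2 * (a2 * (e1 * ex)).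
    by rewrite mulr_ge0// mulr_ge0.
  have h3 : 0 <= m ^+ 2 * c ^+ 2 * (aa * l) by rewrite mulr_ge0// mulr_ge0.
  lra.
- apply: (@le_trans _ _ (v * (c * a) + m ^+ 2 * (c ^+ 2 * g + 2^-1 * c2 * a2) -
    m * (c * a) * (m * (c * b)))); first by rewrite lerD2r.
  have h1 : m ^+ 2 * c ^+ 2 * g <=
      m ^+ 2 * c ^+ 2 * (a * b + (a2 * (e1 * ex) + aa * l)).
    rewrite ler_wpM2l//; apply: le_trans g_le _; rewrite lerD2r.
    by rewrite ler_wpM2l.
  have h2 : 0 <= m ^+ 2 * c ^+ 2 * (a ^+ 2 * (e1 * ex)).
    by rewrite mulr_ge0// mulr_ge0// sqr_ge0.
  have h3 : 0 <= m ^+ 2 * c ^+ 2 * (a * a1 * l).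
    by rewrite mulr_ge0// mulr_ge0// mulr_ge0.
  lra.
Qed.

End subordinated_fractional_skellam.
Theorem theorem3p1 (R : realType) (d : measure_display) (T : measurableType d)
  (P : probability T R) (k : nat) (lambda1 lambda2 alpha : R)
  (hk : (1 <= k)%N) (hlambda1 : 0 < lambda1) (hlambda2 : 0 < lambda2)
  (halpha : 0 < alpha < 1)
  (f : R -> R) (D : R -> T -> R) (hD : levy_subordinator P f D)
  (hmoments : forall r t : R, 0 < r -> 0 <= t ->
     ('E_P[fun w => (D t w `^ r)%R] < +oo)%E)
  (S : R -> T -> R) (hS : FSPoK P k lambda1 lambda2 alpha S)
  (hindep : independent_families P (@nonneg_times R) S (@nonneg_times R) D)
  (rho k1 k2 : R) (hrho : 0 < rho < 1) (hk1 : 0 < k1) (hk2 : 0 < k2)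
  (hk12 : k1 ^+ 2 <= k2)
  (hasymp1 : asymp_equiv (fun t => fine 'E_P[fun w => (D t w `^ alpha)%R])
                         (fun t => k1 * t `^ rho))
  (hasymp2 : asymp_equiv (fun t => fine 'E_P[fun w => (D t w `^ (2 * alpha))%R])
                         (fun t => k2 * t `^ (2 * rho))) :
  LRD P (fun t w => S (D t w) w).
Proof.
have k0 : (0 < k)%N by [].
have [subD _ lapD] := hD.
have [alpha0 alpha1] := andP halpha; have [rho0 rho1] := andP hrho.
have alpha20 : 0 < 2 * alpha by rewrite mulr_gt0.
have [m [v [c [c2 [[v0 c0 cc2] ZL2 ZV Zcov]]]]] :=
  subordinated_moments k0 hlambda1 hlambda2 halpha hS subD lapD hmoments hindep.
pose E := power_moment P D.
have hE1 : E alpha t / t `^ rho @[t --> +oo] --> k1 by exact: asymp_equiv_div.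
have hE2 : E (2 * alpha) t / t `^ (2 * rho) @[t --> +oo] --> k2 by exact: asymp_equiv_div.
have f_gt0 u : 0 < u -> 0 < f u.
  move=> u0.
  have : \forall t \near +oo, 0 < E alpha t / t `^ rho by exact: (cvgr_gt _ hE1).
  move=> near_pos.
  have [t [t0 Et]] : exists t, 0 < t /\ 0 < E alpha t / t `^ rho.
    near (pinfty_nbhs R) => t; exists t; split; near: t => //.
    exact: nbhs_pinfty_gt.
  apply: (laplace_exponent_gt0 subD lapD hmoments alpha0 (ltW t0) u0).
  by move: Et; rewrite pmulr_lgt0// invr_gt0 powR_gt0.
have E_gt0 t : 0 < t -> 0 < E alpha t.
  by move=> t0; exact: (power_moment_gt0 subD lapD hmoments halpha t0 (f_gt0 1 ltr01)).
have E_sqr t : 0 <= t -> E alpha t ^+ 2 <= E (2 * alpha) t.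
  by move=> t0; exact: (power_moment_sqr_le subD hmoments alpha0 t0).
have c2_gt0 : 0 < c2 by apply: le_lt_trans cc2; exact: sqr_ge0.
pose V t := v * c * E alpha t + m ^+ 2 * (c2 * E (2 * alpha) t - c ^+ 2 * E alpha t ^+ 2).
have V_gt0 t : 0 < t -> 0 < V t.
  move=> t0; rewrite /V ltr_pwDl ?mulr_gt0 ?E_gt0// mulr_ge0 ?sqr_ge0// subr_ge0.
  by apply: ler_pM; rewrite ?sqr_ge0 ?E_sqr ?(ltW cc2) ?(ltW t0).
(* Without drift the variance grows like the first power moment of D; otherwise the
   fluctuations of the inverse stable subordinator dominate, and the leading
   coefficient is positive because c ^+ 2 < c2 and k1 ^+ 2 <= k2. *)
have [gamma [kappa [hgamma kappa0 hV]]] : exists gamma kappa : R,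
    [/\ 0 < gamma < 1, 0 < kappa & V t / t `^ (2 * gamma) @[t --> +oo] --> kappa].
  have [m0|m0] := eqVneq m 0.
    exists (2^-1 * rho), (v * c * k1); split; [lra|by rewrite !mulr_gt0|].
    rewrite mulrA mulfV ?pnatr_eq0// mul1r.
    apply: cvg_trans (_ : _ --> _); last exact: cvgM (cvg_cst (v * c)) hE1.
    by apply: near_eq_cvg; near=> t; rewrite /V m0 expr0n mul0r addr0 /= !mulrA.
  exists rho, (v * c * (k1 * 0) + m ^+ 2 * (c2 * k2 - c ^+ 2 * k1 ^+ 2)); split=> //.
    rewrite !mulr0 add0r mulr_gt0 ?exprn_even_gt0// subr_gt0.
    apply: (@lt_le_trans _ _ (c2 * k1 ^+ 2)); first by rewrite ltr_pM2r ?exprn_gt0.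
    by rewrite ler_pM2l.
  have hlim : v * c * (E alpha t / t `^ rho * t `^ (- rho)) + m ^+ 2 *
      (c2 * (E (2 * alpha) t / t `^ (2 * rho)) - c ^+ 2 * (E alpha t / t `^ rho) ^+ 2)
      @[t --> +oo] --> v * c * (k1 * 0) + m ^+ 2 * (c2 * k2 - c ^+ 2 * k1 ^+ 2).
    apply: cvgD; first exact: (cvgM (cvg_cst _) (cvgM hE1 (cvg_powRN rho0))).
    apply: (cvgM (cvg_cst _)); apply: cvgB; first exact: (cvgM (cvg_cst _) hE2).
    by apply: (cvgM (cvg_cst _)); exact: (cvgM hE1 hE1).
  apply: cvg_trans hlim; apply: near_eq_cvg; near=> t.
  have t0 : 0 < t by near: t; exact: nbhs_pinfty_gt.
  have tr : t `^ rho != 0 by rewrite gt_eqF// powR_gt0.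
  rewrite /V powRN [2 * rho]mulrC powRrM powR_mulrn ?powR_ge0//.
  by field.
split; first exact: ZL2.
exists gamma; split=> // s s0; have s_ge0 := ltW s0.
pose C := v * c * E alpha s + m ^+ 2 * (2^-1 * c2 * E (2 * alpha) s).
have C_gt0 : 0 < C.
  rewrite /C ltr_pwDl ?mulr_gt0 ?E_gt0//; apply: mulr_ge0; first exact: sqr_ge0.
  apply: mulr_ge0; first by rewrite mulr_ge0// ltW.
  exact: (power_moment_ge0 subD hmoments (ltW alpha20) s_ge0).
have sigma0 : 0 < Num.sqrt (V s) by rewrite sqrtr_gt0 V_gt0.
exists (C / (Num.sqrt (V s) * Num.sqrt kappa)).
  by rewrite gt_eqF// divr_gt0// mulr_gt0// sqrtr_gt0.
have Ep_ge0 p : 0 <= p -> 0 <= E p s.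
  by move=> p0; exact: (power_moment_ge0 subD hmoments p0 s_ge0).
have cov_cvg : fine (covariance P (fun w => S (D s w) w) (fun w => S (D t w) w))
    @[t --> +oo] --> C.
  apply: (@exp_decay_cvg R _ C _ _ s alpha (fun L => f L^-1) _ _ alpha1 _
    (fun L t L0 st => Zcov s t L s_ge0 st L0)).
  - apply: mulr_ge0; last by rewrite addr_ge0 ?sqr_ge0// Ep_ge0// ltW.
    by apply: mulr_ge0 (expR_ge0 _); rewrite mulr_ge0// sqr_ge0.
  - apply: mulr_ge0; first by rewrite mulr_ge0// sqr_ge0.
    rewrite addr_ge0 ?mulr_ge0 ?Ep_ge0 ?addr_ge0 ?(ltW alpha0)//.
  - by move=> L L0; apply: f_gt0; rewrite invr_gt0.
apply: cvg_trans (_ : _ --> _); last exact: LRD_ratio_cvg kappa0 sigma0 cov_cvg hV.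
by apply: near_eq_cvg; near=> t; rewrite !ZV//.
Unshelve. all: end_near. Qed.
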